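(* There exists $\delta>0$ such that the following holds. Let $(f_a)_a$ be a Hénon $C^4$-$\delta$-like family with $b\ne0$, let $K$ be a horseshoe for this family (a basic set of $f_{a_0}$, with its hyperbolic continuation), and suppose that at $a=a_0$ the family nondegenerately unfolds a homoclinic tangency of a periodic point $\Omega\in K$. Then the set $\mathcal N_1(K)$ of parameters $a$ for which $f_a$ has infinitely many attracting simple sinks has Hausdorff dimension at most $1/2$. In particular, it is a null set for Lebesgue measure.
   Context: A Hénon $C^r$-$\delta$-like family is a family $(f_a)_{a\in(-3,1)}$ of maps of $\mathbb R^2$ of the form $f_a(x,y)=(x^2+a+y,\ bx)+(A_a(x,y),\ b\,B_a(x,y))$, where $b\in\mathbb R$ is constant and $(x,y,a)\mapsto A_a(x,y)$, $(x,y,a)\mapsto B_a(x,y)$ are of class $C^r$ with $C^r$-norms at most $\delta$. A basic set is a transitive, compact invariant hyperbolic set contained in the closure of the set of periodic points; for $a$ near $a_0$ it and its points have hyperbolic continuations for $f_a$. Nondegenerate unfolding. Let $\Omega$ be a saddle periodic point of period $\pi$ with continuation $\Omega_a$. In $C^r$ charts, depending $C^r$ on $a$, of a neighborhood $D$ of $\Omega_a$ which send $\Omega_a$ to $0$ and the local stable and unstable manifolds of $\Omega_a$ for $f_a^\pi$ to $\{0\}\times(-1,1)$ and $(-1,1)\times\{0\}$ respectively, there exist an iterate $n$, a point $P=(p,0)\in D$ sent by $f_{a_0}^{n}$ to $Q=(0,q)\in D$, and a neighborhood $D_P$ of $P$, such that for $t$ small $f^n_{a_0+t}(D_P)\subset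 D$ and $f_{a_0+t}^{n}(P+(x,y))=Q+(\xi x^2+t+\gamma y,\zeta x)+E_t(x,y)$ for $P+(x,y)\in D_P$, with constants $\zeta\in\mathbb R$, $\xi,\gamma\ne0$, and $E_t=(E^1_t,E^2_t)$ of class $C^r$ in $(t,x,y)$ satisfying $E^1=\partial_xE^1=\partial_yE^1=\partial_tE^1=\partial_{xx}E^1=0$ and $E^2=\partial_xE^2=0$ at $(t,x,y)=(0,0,0)$. Simple sinks. In this setting, the following is known: there exist $C>0$, $M\in\mathbb N$ and $N\ge0$ such that for every periodic point $\Omega'\in K$ close to $\Omega$, of period $p'$, a nondegenerate homoclinic unfolding holds for $\Omega'$ at a parameter $a_0'$ close to $a_0$; moreover, if $p'\ge M$ and $\sigma$ denotes the unstable eigenvalue of $D_{\Omega'}f^{p'}_{a_0'}$, there is a parameter interval $I_{\Omega'}$ such that: for every $a\in I_{\Omega'}$ the map $f_a$ has an attracting cycle of minimal period $p'+N$; the length of $I_{\Omega'}$ is in $[\sigma^{-2}/C,\,C\sigma^{-2}]$; and the distance between $I_{\Omega'}$ and $a_0'$ is in $[\sigma^{-1}/C,\,C\sigma^{-1}]$. A simple sink of $f_a$ (with respect to the given homoclinic tangency and $K$) is an attracting cycle produced in this way, i.e. the attracting cycle of period $p'+N$ associated with a periodic point $\Omega'\in K$ close to $\Omega$, of period $p'\ge M$, with $a\in I_{\Omega'}$. *)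

(* Defs.v *)
From HB Require Import structures.
From mathcomp Require Import all_boot all_order all_algebra.
From mathcomp Require Import all_classical all_reals all_analysis.
From mathcomp Require Import complex.

Set Implicit Arguments.
Unset Strict Implicit.
Unset Printing Implicit Defensive.

Import Order.TTheory GRing.Theory Num.Theory.
Import numFieldNormedType.Exports.

Local Open Scope classical_set_scope.
Local Open Scope ring_scope.

(* Points of the plane are row vectors; [z 0 0] is the abscissa of [z] and
   [z 0 1] its ordinate. *)
Definition pt {R : realType} (x y : R) : 'rV[R]_2 :=
  \row_(i < 2) (if i == 0 then x else y).

(* A family [g_a(z)] seen as a function of the three real variables
   [(a, x, y)], in this order. *)
Definition joint {R : realType} {W : Type} (g : R -> 'rV[R]_2 -> W)
    (w : 'rV[R]_3) : W :=
  g (w 0 0) (pt (w 0 1) (w 0 2%:R)).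

(* The subset [{(a, z) | a \in T, z \in D_a}] in the same coordinates. *)
Definition joint_set {R : realType} (T : set R) (D : R -> set 'rV[R]_2) :
    set 'rV[R]_3 :=
  [set w | T (w 0 0) /\ D (w 0 0) (pt (w 0 1) (w 0 2%:R))].

(* [mpartial [:: i1; ..; ik] f] is the iterated partial derivative
   d_i1 (.. (d_ik f)). *)
Definition mpartial {R : realType} {W : normedModType R} {n : nat}
    (s : seq 'I_n.+1) (f : 'rV[R]_n.+1 -> W) : 'rV[R]_n.+1 -> W :=
  foldr (fun i g => 'D_(delta_mx 0 i) g) f s.

Definition class_C {R : realType} {W : normedModType R} {n : nat} (r : nat)
    (U : set 'rV[R]_n.+1) (f : 'rV[R]_n.+1 -> W) : Prop :=
  (forall s : seq 'I_n.+1, (size s < r)%N -> forall i x, U x ->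
     derivable (mpartial s f) x (delta_mx 0 i)) /\
  (forall s : seq 'I_n.+1, (size s <= r)%N -> forall x, U x ->
     {for x, continuous (mpartial s f)}).

Definition C_norm_le {R : realType} {W : normedModType R} {n : nat} (r : nat)
    (U : set 'rV[R]_n.+1) (f : 'rV[R]_n.+1 -> W) (d : R) : Prop :=
  forall s : seq 'I_n.+1, (size s <= r)%N -> forall x, U x ->
    `|mpartial s f x| <= d.

Definition henon_like {R : realType} (r : nat) (d b : R)
    (f : R -> 'rV[R]_2 -> 'rV[R]_2) : Prop :=
  exists A B : R -> 'rV[R]_2 -> R,
    let dom := joint_set `]-3%:R, 1[ (fun=> setT) in
    [/\ class_C r dom (joint A : _ -> R^o),
        class_C r dom (joint B : _ -> R^o),
        C_norm_le r dom (joint A : _ -> R^o) d,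
        C_norm_le r dom (joint B : _ -> R^o) d &
        forall a x y, a \in `]-3%:R, 1[ ->
          f a (pt x y) = pt (x ^+ 2 + a + y) (b * x)
                         + pt (A a (pt x y)) (b * B a (pt x y))].

Definition periodic_point {R : realType} (g : 'rV[R]_2 -> 'rV[R]_2)
    (p : nat) (z : 'rV[R]_2) : Prop :=
  [/\ (0 < p)%N, iter p g z = z &
      forall k, (0 < k < p)%N -> iter k g z <> z].

Definition saddle_periodic_point {R : realType} (g : 'rV[R]_2 -> 'rV[R]_2)
    (p : nat) (z : 'rV[R]_2) : Prop :=
  periodic_point g p z /\
  exists l s : R, [/\ `|l| < 1, 1 < `|s|,
    eigenvalue ('J (iter p g) z) l & eigenvalue ('J (iter p g) z) s].

(* The multipliers of a cycle may be non-real, hence the embedding in R[i]. *)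
Definition attracting_cycle {R : realType} (g : 'rV[R]_2 -> 'rV[R]_2)
    (p : nat) (S : set 'rV[R]_2) : Prop :=
  exists z, [/\ periodic_point g p z,
    S = [set iter k g z | k in [set: nat]] &
    forall l : R[i],
      eigenvalue (map_mx (real_complex R) ('J (iter p g) z)) l -> `|l| < 1].

Definition hyperbolic_on {R : realType} (g : 'rV[R]_2 -> 'rV[R]_2)
    (K : set 'rV[R]_2) : Prop :=
  exists (Es Eu : 'rV[R]_2 -> {vspace 'rV[R]_2}) (C l : R),
    [/\ 0 < C, 0 < l < 1 &
    forall z, K z ->
    [/\ (Es z + Eu z)%VS = fullv /\ (Es z :&: Eu z)%VS = 0%VS,
        [set 'd g z v | v in [set v | v \in Es z]] = [set v | v \in Es (g z)],
        [set 'd g z v | v in [set v | v \in Eu z]] = [set v | v \in Eu (g z)],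
        forall n v, v \in Es z -> `|'d (iter n g) z v| <= C * l ^+ n * `|v| &
        forall n v, v \in Eu z -> `|v| <= C * l ^+ n * `|'d (iter n g) z v|]].

Definition transitive_on {R : realType} (g : 'rV[R]_2 -> 'rV[R]_2)
    (K : set 'rV[R]_2) : Prop :=
  exists2 z, K z & K `<=` closure [set iter n g z | n in [set: nat]].

Definition basic_set {R : realType} (g : 'rV[R]_2 -> 'rV[R]_2)
    (K : set 'rV[R]_2) : Prop :=
  [/\ compact K, g @` K = K, hyperbolic_on g K, transitive_on g K &
      K `<=` closure [set z | exists p, periodic_point g p z]].

(* [h a z] is the hyperbolic continuation, at the parameter [a] of the open
   interval [J], of the point [z] of the hyperbolic set [K] of [f a0]. *)
Definition hyperbolic_continuation {R : realType}
    (f : R -> 'rV[R]_2 -> 'rV[R]_2) (a0 : R) (K : set 'rV[R]_2)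
    (J : set R) (h : R -> 'rV[R]_2 -> 'rV[R]_2) : Prop :=
  [/\ [/\ open J, is_interval J, J a0 & J `<=` `]-3%:R, 1[],
      forall z, K z -> h a0 z = z,
      {within J `*` K, continuous (fun az : R * 'rV[R]_2 => h az.1 az.2)},
      forall a, J a -> set_inj K (h a) /\
        (forall z, K z -> f a (h a z) = h a (f a0 z)) &
      forall a, J a -> hyperbolic_on (f a) (h a @` K)].

Definition local_stable {R : realType} (g : 'rV[R]_2 -> 'rV[R]_2)
    (D : set 'rV[R]_2) (z0 : 'rV[R]_2) : set 'rV[R]_2 :=
  [set z | (forall k, D (iter k g z)) /\
           iter k g z @[k --> \oo] --> z0].

Definition local_unstable {R : realType} (g : 'rV[R]_2 -> 'rV[R]_2)
    (D : set 'rV[R]_2) (z0 : 'rV[R]_2) : set 'rV[R]_2 :=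
  [set z | exists u : nat -> 'rV[R]_2,
    [/\ u 0%N = z, forall k, D (u k), forall k, g (u k.+1) = u k &
        u k @[k --> \oo] --> z0]].

(* [phi a : D a -> 'rV_2], a \in T, are charts depending C^r on [a], with
   inverse charts [psi a]. *)
Definition chart_family {R : realType} (r : nat) (T : set R)
    (D : R -> set 'rV[R]_2) (phi psi : R -> 'rV[R]_2 -> 'rV[R]_2) : Prop :=
  let dom := joint_set T D in
  let im := joint_set T (fun a => phi a @` D a) in
  [/\ open dom, class_C r dom (joint phi),
      open im, class_C r im (joint psi) &
      forall a z, T a -> D a z -> psi a (phi a z) = z].

(* [Om a] is the continuation of the saddle periodic point [Om a0], of period
   [per].  The remainder [E t v] is a function of [(t, x, y)] with [v = (x, y)];
   below, the indices 0, 1, 2 of its partial derivatives refer to [t, x, y]. *)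
Definition nondegenerate_unfolding {R : realType} (r : nat)
    (f : R -> 'rV[R]_2 -> 'rV[R]_2) (a0 : R) (Om : R -> 'rV[R]_2)
    (per : nat) : Prop :=
  saddle_periodic_point (f a0) per (Om a0) /\
  exists (T : set R) (D : R -> set 'rV[R]_2)
         (phi psi : R -> 'rV[R]_2 -> 'rV[R]_2),
  [/\ open T /\ T a0,
      chart_family r T D phi psi,
      forall a, T a ->
        [/\ D a (Om a), phi a (Om a) = 0,
            phi a @` local_stable (iter per (f a)) (D a) (Om a) =
              [set pt 0 y | y in `]-1, 1[] &
            phi a @` local_unstable (iter per (f a)) (D a) (Om a) =
              [set pt x 0 | x in `]-1, 1[]] &
  exists (n : nat) (p q : R) (DP : set 'rV[R]_2) (tau xi gam zeta : R)
         (E : R -> 'rV[R]_2 -> 'rV[R]_2),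
  let P := pt p 0 in
  let Q := pt 0 q in
  let E1 := joint (fun t v => E t v 0 0) : 'rV[R]_3 -> R^o in
  let E2 := joint (fun t v => E t v 0 1) : 'rV[R]_3 -> R^o in
  [/\ [/\ p \in `]-1, 1[, q \in `]-1, 1[ &
          iter n (f a0) (psi a0 P) = psi a0 Q],
      [/\ open DP, DP P, 0 < tau, xi != 0 & gam != 0],
      forall t, `|t| < tau -> T (a0 + t) /\
        let a := a0 + t in
        forall x y, DP (P + pt x y) ->
        [/\ (phi a @` D a) (P + pt x y),
            D a (iter n (f a) (psi a (P + pt x y))) &
            phi a (iter n (f a) (psi a (P + pt x y))) =
              Q + pt (xi * x ^+ 2 + t + gam * y) (zeta * x) + E t (pt x y)],
      class_C r (joint_set [set t | `|t| < tau] (fun=> [set v | DP (P + v)]))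
        (joint E) &
      [/\ E1 0 = 0, mpartial [:: 1] E1 0 = 0, mpartial [:: 2%:R] E1 0 = 0,
          mpartial [:: 0] E1 0 = 0 & mpartial [:: 1; 1] E1 0 = 0] /\
      [/\ E2 0 = 0 & mpartial [:: 1] E2 0 = 0]]].

(* The periodic points of [K] which are close to [Om] are those in the
   neighborhood [V] of [Om].  To such a point [z], of period [p], are attached
   - a parameter [aH z] at which [z] has a nondegenerately unfolding homoclinic
     tangency, at distance at most [eta] of [a0];
   - when [M <= p], a parameter interval [I z] and, for every [a] in [I z], an
     attracting cycle [sink z a] of [f a] of period [p + N]. *)
Definition simple_sink_data {R : realType} (r : nat)
    (f : R -> 'rV[R]_2 -> 'rV[R]_2) (a0 : R) (K : set 'rV[R]_2)
    (J : set R) (h : R -> 'rV[R]_2 -> 'rV[R]_2) (Om : 'rV[R]_2)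
    (C : R) (M N : nat) (V : set 'rV[R]_2) (eta : R)
    (aH : 'rV[R]_2 -> R) (I : 'rV[R]_2 -> set R)
    (sink : 'rV[R]_2 -> R -> set 'rV[R]_2) : Prop :=
  [/\ 0 < C, nbhs Om V, 0 < eta, `[a0 - eta, a0 + eta] `<=` J &
  forall z p, K z -> V z -> periodic_point (f a0) p z ->
  [/\ `|aH z - a0| <= eta,
      nondegenerate_unfolding r f (aH z) (h ^~ z) p &
      (M <= p)%N -> forall s : R,
        1 < `|s| -> eigenvalue ('J (iter p (f (aH z))) (h (aH z) z)) s ->
      [/\ is_interval (I z) /\ I z `<=` `]-3%:R, 1[,
          forall a, I z a -> attracting_cycle (f a) (p + N) (sink z a),
          sup (I z) - inf (I z) \in `[`|s| ^- 2 / C, C * `|s| ^- 2] &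
          inf [set `|a - aH z| | a in I z] \in
            `[`|s|^-1 / C, C * `|s|^-1]]]].

Definition simple_sinks {R : realType}
    (f : R -> 'rV[R]_2 -> 'rV[R]_2) (a0 : R) (K : set 'rV[R]_2) (M : nat)
    (V : set 'rV[R]_2) (I : 'rV[R]_2 -> set R)
    (sink : 'rV[R]_2 -> R -> set 'rV[R]_2) (a : R) : set (set 'rV[R]_2) :=
  [set S | exists z p, [/\ K z, V z, periodic_point (f a0) p z, (M <= p)%N &
                           I z a /\ S = sink z a]].

Local Open Scope ereal_scope.

Definition diam {R : realType} (U : set R) : \bar R :=
  ereal_sup [set (`|xy.1 - xy.2|)%:E | xy in U `*` U].

(* (diam U)^s, with the convention that it is 0 for the empty set, even when
   s = 0; note that 0 `^ 0 = 1, so that H^0 is the counting measure. *)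
Definition diam_pow {R : realType} (s : R) (U : set R) : \bar R :=
  if U == set0 then 0 else diam U `^ s.

Definition hausdorff_content {R : realType} (s e : R) (X : set R) : \bar R :=
  ereal_inf [set \sum_(0 <= i <oo) diam_pow s (U i) | U in
    [set U : nat -> set R | (forall i, diam (U i) <= e%:E) /\
                            X `<=` \bigcup_i U i]].

Definition hausdorff_measure {R : realType} (s : R) (X : set R) : \bar R :=
  ereal_sup [set hausdorff_content s e X | e in [set e : R | (0 < e)%R]].

Definition hausdorff_dim {R : realType} (X : set R) : \bar R :=
  ereal_inf [set s%:E | s in
    [set s : R | (0 <= s)%R /\ hausdorff_measure s X = 0]].

(* Main.v *)
Require Import Defs.
From mathcomp Require Import all_boot all_order all_algebra.
From mathcomp Require Import all_classical all_reals all_analysis.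
From mathcomp Require Import measurable_realfun ring lra.
Import Order.TTheory GRing.Theory Num.Theory.
Import numFieldNormedType.Exports.
Local Open Scope classical_set_scope.
Local Open Scope ring_scope.

Set Implicit Arguments.
Unset Strict Implicit.
Unset Printing Implicit Defensive.

(** A parameter with infinitely many simple sinks belongs to infinitely many of
    the intervals [I z], where [z] runs over the periodic points of [K] close to
    [Om].  The length of [I z] is at most [C * |sigma_z| ^- 2], where [sigma_z] is
    the unstable multiplier of [z] at the parameter [aH z].  Hence it suffices
    that the sum of the [|sigma_z| ^- t] over all these points converges for every
    [t > 1]: with [t = 2 s] it bounds the s-dimensional Hausdorff sums of the
    covers by the [I z], whose tails are arbitrarily small
    ([limsup_hausdorff_measure0]), and with [t = 2] the Borel-Cantelli lemma
    applies ([limsup_negligible]).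

    To bound the sum, fix a parameter [a1], let [g = f a1], and let [X] be the
    continuation of [K] at [a1].  In an adapted frame, [g] multiplies the unstable
    coordinate along the orbit of a periodic point by factors [A_0, A_1, ..] of
    modulus at least [1 / l > 1], and the stable one by factors of modulus at most
    [l].  Two estimates are combined.

    - Counting ([period_sum]).  Take a short straight segment through a point [y]
      of [X] in the unstable direction of [y], and a point [x] of [X], of period
      [p], close to [y] and with nearly the same unstable direction.  By the
      intermediate value theorem the images of the segment keep crossing the
      boxes around the orbit of [x] from side to side ([nested_crossings]).  So a
      piece of the segment shadows [x] during [p] steps and crosses the last box;
      as [g ^ p] stretches it at most by the product of the [|A_k| + eps], its
      length is at least a constant times the inverse of this product
      ([shadowing_interval]).  The pieces of two distinct points of period [p] are
      disjoint, because [g] is expansive near [X] ([frame_expansive]).  Finitely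
      many segments serve all the points of [X], hence the sum, over the points of
      period [p], of the inverses of these products has a bound independent of
      [p].

    - Multipliers ([frame_multiplier]).  By a cone argument, the multiplier
      [sigma_z] at a parameter close to [a1] has modulus at least the product of
      the [|A_k| - eps].

    As [t > 1], the factor [|sigma_z| ^ (1 - t)] is exponentially small in the
    period, and it absorbs the ratio of the two products when [eps] is small; the
    contributions of the successive periods then decay geometrically
    ([multiplier_sum]).  This works for the points [z] with [aH z] in a
    neighborhood of [a1], and finitely many such neighborhoods cover the segment
    of parameters under consideration ([bounded_sums_cover]).

    With [delta = 1], the second derivatives of the maps [f a] are bounded
    uniformly on the plane, which makes all the linearizations uniform
    ([henon_estimates]). *)

(** * Almost diagonal linear recursions *)

(** The two coordinates of a tangent vector, or of the difference of two nearby
    orbits, in moving frames which diagonalize the derivative: [e] measures the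
    deviation from the diagonal linear recursion. *)
Definition almost_split {R : realType} (n : nat) (A B : nat -> R) (e : R)
    (u v : nat -> R) : Prop :=
  forall k, (k < n)%N ->
    `|u k.+1 - A k * u k| <= e * Num.max `|u k| `|v k| /\
    `|v k.+1 - B k * v k| <= e * Num.max `|u k| `|v k|.

(** Once the expanded coordinate dominates, it dominates forever: at each step it
    is multiplied by at least one, even after subtracting the error. *)
Lemma cone_expand {R : realType} (n : nat) (A B : nat -> R) (e l : R)
    (u v : nat -> R) :
  0 <= e -> l + e <= 1 ->
  (forall k, (k < n)%N -> 1 + e <= `|A k| /\ `|B k| <= l) ->
  almost_split n A B e u v -> `|v 0%N| <= `|u 0%N| ->
  `|v n| <= `|u n| /\ (\prod_(k < n) (`|A k| - e)) * `|u 0%N| <= `|u n|.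
Proof.
move=> e0 le1; elim: n => [|n IH] hAB hs vu.
  by rewrite big_ord0 mul1r.
have [vun pun] : `|v n| <= `|u n| /\
    (\prod_(k < n) (`|A k| - e)) * `|u 0%N| <= `|u n|.
  by apply: IH => // k kn; [apply: hAB|apply: hs]; rewrite ltnS ltnW.
have [hA hB] := hAB n (ltnSn n); have [hu hv] := hs n (ltnSn n).
rewrite (max_l vun) in hu hv.
have un0 := normr_ge0 (u n); have vn0 := normr_ge0 (v n).
have hu1 : `|A n| * `|u n| - e * `|u n| <= `|u n.+1|.
  have := ler_normB (u n.+1) (u n.+1 - A n * u n).
  by rewrite opprB addrC subrK normrM; lra.
have hv1 : `|v n.+1| <= l * `|u n| + e * `|u n|.
  have := ler_normD (B n * v n) (v n.+1 - B n * v n).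
  rewrite addrC subrK normrM => h.
  have : `|B n| * `|v n| <= l * `|u n| by apply: ler_pM.
  by lra.
split; first by nra.
rewrite big_ord_recr /= -mulrA (mulrC _ `|u 0%N|) mulrA.
apply: le_trans hu1; rewrite -mulrBl mulrC; apply: ler_wpM2l => //.
by lra.
Qed.

(** If the contracted coordinate dominates at the end, then by [cone_expand] it
    has dominated all along, so it has been contracted at every step. *)
Lemma cone_contract {R : realType} (n : nat) (A B : nat -> R) (e l : R)
    (u v : nat -> R) :
  0 <= e -> 0 <= l -> l + e <= 1 ->
  (forall k, (k < n)%N -> 1 + e <= `|A k| /\ `|B k| <= l) ->
  almost_split n A B e u v -> `|u n| < `|v n| ->
  `|u 0%N| < `|v 0%N| /\ `|v n| <= (l + e) ^+ n * `|v 0%N|.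
Proof.
move=> e0 l0 le1; elim: n => [|n IH] hAB hs vu.
  by rewrite expr0 mul1r.
have uv : `|u n| < `|v n|.
  rewrite ltNge; apply/negP => vun.
  have hs1 : almost_split 1 (fun k => A (k + n)%N) (fun k => B (k + n)%N) e
      (fun k => u (k + n)%N) (fun k => v (k + n)%N).
    by move=> k; rewrite ltnS leqn0 => /eqP ->; exact: hs.
  have [|h _] := cone_expand e0 le1 _ hs1 vun.
    by move=> k; rewrite ltnS leqn0 => /eqP ->; exact: hAB.
  by move: vu; rewrite ltNge h.
have [|||h1 h2] := IH => //.
  by move=> k kn; apply: hAB; rewrite ltnS ltnW.
  by move=> k kn; apply: hs; rewrite ltnS ltnW.
split => //.
have [hA hB] := hAB n (ltnSn n); have [hu hv] := hs n (ltnSn n).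
rewrite (max_r (ltW uv)) in hv.
rewrite exprS -mulrA; apply: (@le_trans _ _ ((l + e) * `|v n|)); last first.
  by apply: ler_wpM2l => //; lra.
have := ler_normD (B n * v n) (v n.+1 - B n * v n).
rewrite addrC subrK normrM => h.
have : `|B n| * `|v n| <= l * `|v n| by apply: ler_pM.
by lra.
Qed.

Lemma almost_split_growth {R : realType} (n : nat) (A B : nat -> R) (e : R)
    (u v : nat -> R) :
  0 <= e -> (forall k, (k < n)%N -> `|B k| <= `|A k|) ->
  almost_split n A B e u v ->
  Num.max `|u n| `|v n| <=
    (\prod_(k < n) (`|A k| + e)) * Num.max `|u 0%N| `|v 0%N|.
Proof.
move=> e0; elim: n => [|n IH] hAB hs; first by rewrite big_ord0 mul1r.
have {}IH : Num.max `|u n| `|v n| <=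
    (\prod_(k < n) (`|A k| + e)) * Num.max `|u 0%N| `|v 0%N|.
  by apply: IH => // k kn; [apply: hAB|apply: hs]; rewrite ltnS ltnW.
have hA := hAB n (ltnSn n); have [hu hv] := hs n (ltnSn n).
rewrite big_ord_recr /= -mulrA mulrCA.
apply: (@le_trans _ _ ((`|A n| + e) * Num.max `|u n| `|v n|)); last first.
  by apply: ler_wpM2l => //; have := normr_ge0 (A n); lra.
have um : `|u n| <= Num.max `|u n| `|v n| by rewrite le_max lexx.
have vm : `|v n| <= Num.max `|u n| `|v n| by rewrite le_max lexx orbT.
rewrite ge_max; apply/andP; split.
  have := ler_normD (A n * u n) (u n.+1 - A n * u n).
  rewrite addrC subrK normrM => h.
  have : `|A n| * `|u n| <= `|A n| * Num.max `|u n| `|v n| by apply: ler_pM.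
  by lra.
have := ler_normD (B n * v n) (v n.+1 - B n * v n).
rewrite addrC subrK normrM => h.
have : `|B n| * `|v n| <= `|A n| * Num.max `|u n| `|v n| by apply: ler_pM.
by lra.
Qed.

(** A vector which comes back multiplied by [s], with [|s| >= 1], cannot lie
    outside the cone, since there it would be contracted.  With [s] the unstable
    multiplier of a cycle this bounds [|s|] from below; with [s = 1] it forbids
    two periodic orbits to shadow each other. *)
Lemma cyclic_multiplier {R : realType} (n : nat) (A B : nat -> R) (e l s : R)
    (u v : nat -> R) :
  (0 < n)%N -> 0 <= e -> 0 <= l -> l + e < 1 ->
  (forall k, (k < n)%N -> 1 + e <= `|A k| /\ `|B k| <= l) ->
  almost_split n A B e u v ->
  u n = s * u 0%N -> v n = s * v 0%N -> 1 <= `|s| ->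
  0 < Num.max `|u 0%N| `|v 0%N| ->
  \prod_(k < n) (`|A k| - e) <= `|s|.
Proof.
move=> n0 e0 l0 le1 hAB hs un vn s1 uv0.
case: (lerP `|v 0%N| `|u 0%N|) => vu.
  rewrite (max_l vu) in uv0.
  have [_] := cone_expand e0 (ltW le1) hAB hs vu.
  by rewrite un normrM ler_pM2r.
rewrite (max_r (ltW vu)) in uv0.
have uvn : `|u n| < `|v n|.
  by rewrite un vn !normrM ltr_pM2l // (lt_le_trans _ s1).
have [_] := cone_contract e0 l0 (ltW le1) hAB hs uvn.
rewrite vn normrM ler_pM2r // => h.
have : (l + e) ^+ n < 1 by rewrite exprn_ilt1 // ?lt0n_neq0 //; lra.
by lra.
Qed.

(** * Curves that cross a sequence of boxes *)

(** The interval starts at the last point where [f <= - rho] and ends at the next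
    point where [rho <= f]. *)
Lemma crossing_subinterval {R : realType} (f : R -> R) (a b rho : R) :
  continuous f -> a <= b -> f a <= - rho -> rho <= f b -> 0 < rho ->
  exists c d, [/\ a <= c, c <= d, d <= b, f c = - rho /\ f d = rho &
    forall t, c <= t <= d -> `|f t| <= rho].
Proof.
move=> cf ab fa fb rho0.
have clF (D : set R) : closed D -> closed (f @^-1` D).
  by move=> cD; apply: preimage_closed => // x _; exact: cf.
have cid (S : set R) : {within S, continuous (@idfun R)}.
  by apply: continuous_subspaceT => x; exact: cvg_id.
pose S := `[a, b]%classic `&` f @^-1` [set y | y <= - rho].
have [c cS cmax] : exists2 c, c \in S & forall t, t \in S -> t <= c.
  apply: (@compact_EVT_max _ R idfun S) => //.
    by exists a; split => //=; rewrite in_itv /= lexx ab.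
  apply: (subclosed_compact _ (@segment_compact R a b)) => [|x []//].
  by apply: closedI; [exact: itv_closed|apply: clF; exact: closed_le].
move: cS; rewrite inE => -[]; rewrite /= in_itv /= => /andP[ac cb] fc.
pose S' := `[c, b]%classic `&` f @^-1` [set y | rho <= y].
have [d dS dmin] : exists2 d, d \in S' & forall t, t \in S' -> d <= t.
  apply: (@compact_EVT_min _ R idfun S') => //.
    by exists b; split => //=; rewrite in_itv /= lexx cb.
  apply: (subclosed_compact _ (@segment_compact R c b)) => [|x []//].
  by apply: closedI; [exact: itv_closed|apply: clF; exact: closed_ge].
move: dS; rewrite inE => -[]; rewrite /= in_itv /= => /andP[cd db] fd.
have lo t : c < t -> t <= b -> - rho < f t.
  move=> ct tb; rewrite ltNge; apply/negP => ft.
  have /cmax : t \in S.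
    by rewrite inE; split => //=; rewrite in_itv /= tb andbT; lra.
  by lra.
have hi t : c <= t -> t < d -> f t < rho.
  move=> ct td; rewrite ltNge; apply/negP => ft.
  have /dmin : t \in S'.
    by rewrite inE; split => //=; rewrite in_itv /= ct /=; lra.
  by lra.
have iv x y v : x <= y -> f x <= v <= f y -> exists2 z, z \in `[x, y] & f z = v.
  move=> xy /andP[xv vy]; apply: IVT => //.
    exact: continuous_subspaceT.
  by rewrite ge_min xv /= le_max vy orbT.
have fcE : f c = - rho.
  apply/eqP; rewrite eq_le fc /=.
  have [|z] := iv c b (- rho) cb; first by rewrite fc /=; lra.
  rewrite in_itv /= le_eqVlt => /andP[/orP[/eqP <-|cz] zb] fz.
    by rewrite fz.
  by have := lo _ cz zb; lra.
have fdE : f d = rho.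
  apply/eqP; rewrite eq_le fd andbT.
  have [|z] := iv c d rho cd; first by rewrite fd andbT; lra.
  rewrite in_itv /= [z <= d]le_eqVlt => /andP[cz /orP[/eqP <-|zd]] fz.
    by rewrite fz.
  by have := hi _ cz zd; lra.
exists c, d; split => // t /andP[ct td]; rewrite ler_norml; apply/andP; split.
  move: ct; rewrite le_eqVlt => /orP[/eqP <-|cz].
    by rewrite fcE.
  by apply/ltW/lo => //; lra.
move: td; rewrite le_eqVlt => /orP[/eqP ->|cz]; first by rewrite fdE.
by apply/ltW/hi.
Qed.

(** Both orientations occur, since the expansion factors may be negative. *)
Definition crosses {R : realType} (rho : R) (f : R -> R) (c d : R) : Prop :=
  (f c = - rho /\ f d = rho) \/ (f c = rho /\ f d = - rho).

Lemma crosses_expand {R : realType} (f : R -> R) (rho a b : R) :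
  continuous f -> a <= b -> 0 < rho ->
  (f a <= - rho /\ rho <= f b) \/ (f b <= - rho /\ rho <= f a) ->
  exists c d, [/\ a <= c, c <= d, d <= b, crosses rho f c d &
    forall t, c <= t <= d -> `|f t| <= rho].
Proof.
move=> cf ab rho0 [[fa fb]|[fb fa]].
  have [c [d [ac cd db fcd H]]] := crossing_subinterval cf ab fa fb rho0.
  by exists c, d; split => //; left.
have cNf : continuous (fun t => - f t) by move=> x; apply: cvgN; exact: cf.
have [||c [d [ac cd db [fc fd] H]]] :=
    crossing_subinterval (rho := rho) cNf ab _ _ rho0; try lra.
exists c, d; split => //; first by right; split; lra.
by move=> t /H; rewrite normrN.
Qed.

(** Inductively, on the current interval [u n] runs from [- rho] to [rho] or
    back, hence [u n.+1] runs from beyond one of these values to beyond the other,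
    and it crosses again on a subinterval; there [v] stays bounded because it is
    contracted.  No control of the slope of the curve is required, only the
    values of its coordinates. *)
Lemma nested_crossings {R : realType} (n : nat) (u v : nat -> R -> R)
    (A B : nat -> R) (e l rho a b : R) :
  0 <= e -> l + e <= 1 -> 0 < rho -> a <= b ->
  (forall k, (k < n)%N -> 1 + e <= `|A k| /\ `|B k| <= l) ->
  (forall k, continuous (u k)) ->
  u 0%N a <= - rho -> rho <= u 0%N b ->
  (forall t, a <= t <= b -> `|v 0%N t| <= rho) ->
  (forall k t, (k < n)%N -> `|u k t| <= rho -> `|v k t| <= rho ->
    `|u k.+1 t - A k * u k t| <= e * rho /\
    `|v k.+1 t - B k * v k t| <= e * rho) ->
  exists c d, [/\ a <= c, c <= d, d <= b, crosses rho (u n) c d &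
    forall k t, (k <= n)%N -> c <= t <= d -> `|u k t| <= rho /\ `|v k t| <= rho].
Proof.
move=> e0 le1 rho0 ab; elim: n => [|n IH] hAB cu ua ub v0 H.
  have [|c [d [ac cd db cr h]]] := crosses_expand (cu 0%N) ab rho0; first by left.
  exists c, d; split => // k t; rewrite leqn0 => /eqP -> tcd; split.
    exact: h.
  by apply: v0; move/andP: tcd => [ct td]; rewrite (le_trans ac ct) (le_trans td).
have [||c [d [ac cd db cr h]]] := IH _ cu ua ub v0.
  by move=> k kn; apply: hAB; rewrite ltnS ltnW.
  by move=> k t kn; apply: H; rewrite ltnS ltnW.
have [hA hB] := hAB n (ltnSn n).
have step t : c <= t <= d -> `|u n.+1 t - A n * u n t| <= e * rho /\
    `|v n.+1 t| <= rho.
  move=> tcd; have [hu hv] := h n t (leqnn n) tcd.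
  have [h1 h2] := H n t (ltnSn n) hu hv; split => //.
  have := ler_normD (B n * v n t) (v n.+1 t - B n * v n t).
  rewrite addrC subrK normrM => h3.
  have : `|B n| * `|v n t| <= l * rho by apply: ler_pM.
  by nra.
have [su _] : `|u n.+1 c - A n * u n c| <= e * rho /\ `|v n.+1 c| <= rho.
  by apply: step; rewrite lexx.
have [sv _] : `|u n.+1 d - A n * u n d| <= e * rho /\ `|v n.+1 d| <= rho.
  by apply: step; rewrite lexx andbT.
have [|c' [d' [cc' cd' dd' cr' h']]] :=
    crosses_expand (rho := rho) (cu n.+1) cd rho0.
  move: su sv; rewrite !ler_norml => /andP[su1 su2] /andP[sv1 sv2].
  have [A0|A0] := lerP 0 (A n); move: hA; rewrite ?(ger0_norm A0) ?(ltr0_norm A0).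
    by case: cr => -[uc ud] hA; rewrite uc in su1 su2; rewrite ud in sv1 sv2;
      [left|right]; split; clear -hA A0 rho0 e0 su1 su2 sv1 sv2; nra.
  by case: cr => -[uc ud] hA; rewrite uc in su1 su2; rewrite ud in sv1 sv2;
    [right|left]; split; clear -hA A0 rho0 e0 su1 su2 sv1 sv2; nra.
exists c', d'; split => //; first exact: (le_trans ac).
  exact: le_trans db.
move=> k t; rewrite leq_eqVlt => /orP[/eqP -> tcd|].
  split; first exact: h'.
  by apply: (step t _).2; move/andP: tcd => [h1 h2]; rewrite (le_trans cc')//=
    (le_trans h2).
rewrite ltnS => kn tcd; apply: h => //.
by move/andP: tcd => [h1 h2]; rewrite (le_trans cc')//= (le_trans h2).
Qed.

(** * Coordinates in the plane and derivatives of iterates *)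

Lemma row2_norm {R : realType} (v : 'rV[R]_2) :
  `|v| = Num.max `|v 0 0| `|v 0 1|.
Proof.
rewrite [LHS]mx_normrE; apply/eqP; rewrite eq_le; apply/andP; split.
  apply/bigmax_leP; split; first by rewrite le_max normr_ge0.
  move=> [i j] _ /=; rewrite (ord1 i).
  by case: (unliftP ord0 j) => [k ->|->]; rewrite ?(ord1 k) le_max; apply/orP;
    [right|left]; rewrite le_eqVlt; apply/orP; left; apply/eqP; congr (`|v _ _|);
    apply/val_inj.
rewrite ge_max; apply/andP; split.
  exact: (le_bigmax_cond _ (fun ij : 'I_1 * 'I_2 => `|v ij.1 ij.2|) (j := (0, 0))).
exact: (le_bigmax_cond _ (fun ij : 'I_1 * 'I_2 => `|v ij.1 ij.2|) (j := (0, 1))).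
Qed.

Lemma row2P {R : realType} (v w : 'rV[R]_2) :
  v 0 0 = w 0 0 -> v 0 1 = w 0 1 -> v = w.
Proof.
move=> h0 h1; apply/rowP => j.
case: (unliftP ord0 j) => [k ->|->]; rewrite ?(ord1 k).
  by have -> : lift ord0 0 = 1 :> 'I_2 by apply/val_inj.
by have -> : ord0 = 0 :> 'I_2 by apply/val_inj.
Qed.

Definition det2 {R : realType} (v w : 'rV[R]_2) : R :=
  v 0 0 * w 0 1 - v 0 1 * w 0 0.

(** Coordinates in the basis [(e, f)], by Cramer's rule. *)
Definition crd1 {R : realType} (e f v : 'rV[R]_2) : R := det2 v f / det2 e f.
Definition crd2 {R : realType} (e f v : 'rV[R]_2) : R := det2 e v / det2 e f.

Lemma crd1_lin {R : realType} (e f v w : 'rV[R]_2) (t : R) :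
  crd1 e f (t *: v + w) = t * crd1 e f v + crd1 e f w.
Proof. by rewrite /crd1 /det2 !mxE; ring. Qed.

Lemma crd2_lin {R : realType} (e f v w : 'rV[R]_2) (t : R) :
  crd2 e f (t *: v + w) = t * crd2 e f v + crd2 e f w.
Proof. by rewrite /crd2 /det2 !mxE; ring. Qed.

Lemma crdK {R : realType} (e f v : 'rV[R]_2) : det2 e f != 0 ->
  v = crd1 e f v *: e + crd2 e f v *: f.
Proof.
rewrite /crd1 /crd2 /det2 => d0; apply: row2P; rewrite !mxE; field; exact: d0.
Qed.

Lemma crd_comb {R : realType} (e f : 'rV[R]_2) (a b : R) : det2 e f != 0 ->
  crd1 e f (a *: e + b *: f) = a /\ crd2 e f (a *: e + b *: f) = b.
Proof.
by rewrite /crd1 /crd2 /det2 => d0; split; rewrite !mxE; field; exact: d0.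
Qed.

Lemma det2_neq0 {R : realType} (U V : {vspace 'rV[R]_2}) (e f : 'rV[R]_2) :
  (U :&: V)%VS = 0%VS -> e \in U -> f \in V -> e != 0 -> f != 0 -> det2 e f != 0.
Proof.
move=> UV eU fV e0 f0; apply/eqP => d0.
have [t te] : exists t, f = t *: e.
  move: e0; rewrite -normr_eq0 row2_norm => e0.
  move: d0; rewrite /det2 => /eqP; rewrite subr_eq0 => /eqP d0.
  have [h|h] := eqVneq (e 0 0) 0; last first.
    exists (f 0 0 / e 0 0); apply: row2P; rewrite !mxE; first by field.
    by rewrite mulrAC [f 0 0 * _]mulrC -d0; field.
  have h1 : e 0 1 != 0.
    by apply: contraNneq e0 => ->; rewrite h normr0 maxxx.
  exists (f 0 1 / e 0 1); apply: row2P; rewrite !mxE; last by field.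
  by rewrite mulrAC [f 0 1 * _]mulrC d0; field.
suff: f \in (U :&: V)%VS by rewrite UV memv0 (negbTE f0).
by rewrite memv_cap fV andbT te rpredZ.
Qed.

(** In the plane, two complementary subspaces with a nonzero vector each are lines,
    so their elements have a single nonzero coordinate. *)
Lemma eigenline {R : realType} (U V : {vspace 'rV[R]_2}) (e f v : 'rV[R]_2) :
  (U :&: V)%VS = 0%VS -> e \in U -> f \in V -> e != 0 -> f != 0 ->
  (v \in U -> v = crd1 e f v *: e) /\ (v \in V -> v = crd2 e f v *: f).
Proof.
move=> UV eU fV e0 f0; have d0 := det2_neq0 UV eU fV e0 f0.
have vE := crdK v d0; split => hv.
  suff: crd2 e f v *: f \in (U :&: V)%VS.
    by rewrite UV memv0 => /eqP h; rewrite {1}vE h addr0.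
  rewrite memv_cap [X in _ && X]rpredZ // andbT.
  have -> : crd2 e f v *: f = v - crd1 e f v *: e by rewrite {2}vE addrC addKr.
  by rewrite rpredB // rpredZ.
suff: crd1 e f v *: e \in (U :&: V)%VS.
  by rewrite UV memv0 => /eqP h; rewrite {1}vE h add0r.
rewrite memv_cap [X in X && _]rpredZ //=.
have -> : crd1 e f v *: e = v - crd2 e f v *: f by rewrite {2}vE addrK.
by rewrite rpredB // rpredZ.
Qed.

Lemma differentiable_iter {R : realType} (g : 'rV[R]_2 -> 'rV[R]_2) n x :
  (forall x, differentiable g x) -> differentiable (iter n g) x.
Proof.
move=> dg; elim: n => [|n IH].
  have := @linear_differentiable _ _ _ (idfun : {linear 'rV[R]_2 -> 'rV[R]_2}) x.
  by apply => y; exact: cvg_id.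
exact: (@differentiable_comp _ _ _ _ (iter n g) g x IH (dg _)).
Qed.

Lemma diff_iterSr {R : realType} (g : 'rV[R]_2 -> 'rV[R]_2) n x v :
  (forall x, differentiable g x) ->
  'd (iter n.+1 g) x v = 'd (iter n g) (g x) ('d g x v).
Proof.
move=> dg; have -> : iter n.+1 g = iter n g \o g.
  by apply/funext => y /=; rewrite -iterSr.
exact: (congr1 (fun h => h v)
  (@diff_comp _ _ _ _ g (iter n g) x (dg x) (differentiable_iter n (g x) dg))).
Qed.

Lemma diff_iter0 {R : realType} (g : 'rV[R]_2 -> 'rV[R]_2) x v :
  'd (iter 0 g) x v = v.
Proof.
have -> : iter 0 g = (idfun : {linear 'rV[R]_2 -> 'rV[R]_2}) by [].
by rewrite diff_lin // => y; exact: cvg_id.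
Qed.

Lemma diff_iterS {R : realType} (g : 'rV[R]_2 -> 'rV[R]_2) n x v :
  (forall x, differentiable g x) ->
  'd (iter n.+1 g) x v = 'd g (iter n g x) ('d (iter n g) x v).
Proof.
move=> dg; have dn := differentiable_iter n x dg.
exact: (congr1 (fun h => h v)
  (@diff_comp _ _ _ _ (iter n g) g x dn (dg (iter n g x)))).
Qed.

Lemma inf_scale {R : realType} (F : nat -> R) (c : R) :
  (forall n, 0 <= F n) -> 0 < c ->
  inf (range (fun n => c * F n)) = c * inf (range F).
Proof.
move=> F0 c0.
have hF : has_lbound (range F) by exists 0 => _ [n _ <-].
have hcF : has_lbound (range (fun n => c * F n)).
  by exists 0 => _ [n _ <-]; rewrite mulr_ge0 // ltW.
apply/eqP; rewrite eq_le; apply/andP; split.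
  rewrite -ler_pdivrMl //; apply: lb_le_inf; first by exists (F 0%N), 0%N.
  move=> _ [n _ <-]; rewrite ler_pdivrMl //; apply: ge_inf => //; by exists n.
apply: lb_le_inf; first by exists (c * F 0%N), 0%N.
move=> _ [n _ <-]; rewrite ler_pM2l //; apply: ge_inf => //; by exists n.
Qed.

Lemma sup_scale {R : realType} (F : nat -> R) (c : R) :
  has_ubound (range F) -> 0 < c ->
  sup (range (fun n => c * F n)) = c * sup (range F).
Proof.
move=> hF c0.
have hcF : has_ubound (range (fun n => c * F n)).
  have [M hM] := hF; exists (c * M) => _ [n _ <-].
  by rewrite ler_pM2l //; apply: hM; exists n.
apply/eqP; rewrite eq_le; apply/andP; split.
  apply: ge_sup; first by exists (c * F 0%N), 0%N.
  move=> _ [n _ <-]; rewrite ler_pM2l //; apply: ub_le_sup => //; by exists n.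
rewrite -ler_pdivlMl //; apply: ge_sup; first by exists (F 0%N), 0%N.
move=> _ [n _ <-]; rewrite ler_pdivlMl //; apply: ub_le_sup => //; by exists n.
Qed.

(** * Adapted frames of a hyperbolic set *)

(** In the plane, this says that the stable and unstable spaces are lines along
    the whole forward orbit of [x]. *)
Definition split_at {R : realType} (g : 'rV[R]_2 -> 'rV[R]_2)
    (Es Eu : 'rV[R]_2 -> {vspace 'rV[R]_2}) (x : 'rV[R]_2) : Prop :=
  forall k, (exists2 u, u \in Eu (iter k g x) & u != 0) /\
            (exists2 s, s \in Es (iter k g x) & s != 0).

(** The frame [(e x, f x)] spans the unstable and stable lines at [x], with the
    vectors normalized so that one iteration already expands and contracts: the
    constant in front of the rates of a hyperbolic set is absorbed in [Q]. *)
Record adapted_frame {R : realType} (g : 'rV[R]_2 -> 'rV[R]_2)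
    (X : set 'rV[R]_2) (l Q : R) (e f : 'rV[R]_2 -> 'rV[R]_2)
    (A B : 'rV[R]_2 -> R) : Prop := AdaptedFrame {
  frame_det : forall x, X x -> det2 (e x) (f x) != 0;
  frame_dyn : forall x v, X x ->
    crd1 (e (g x)) (f (g x)) ('d g x v) = A x * crd1 (e x) (f x) v /\
    crd2 (e (g x)) (f (g x)) ('d g x v) = B x * crd2 (e x) (f x) v;
  frame_rate : forall x, X x -> l^-1 <= `|A x| /\ `|B x| <= l;
  frame_crd : forall x v, X x ->
    [/\ `|crd1 (e x) (f x) v| <= Q * `|v|, `|crd2 (e x) (f x) v| <= Q * `|v| &
        `|v| <= Q * Num.max `|crd1 (e x) (f x) v| `|crd2 (e x) (f x) v|];
  frame_vec : forall x, X x -> `|e x| <= Q }.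

Lemma diff_iter_bound {R : realType} (g : 'rV[R]_2 -> 'rV[R]_2)
    (X : set 'rV[R]_2) (L : R) n x v :
  (forall x, differentiable g x) -> (forall x, X x -> X (g x)) -> 0 <= L ->
  (forall x v, X x -> `|'d g x v| <= L * `|v|) -> X x ->
  `|'d (iter n g) x v| <= L ^+ n * `|v|.
Proof.
move=> dg gX L0 hL; elim: n x v => [|n IH] x v Xx.
  by rewrite diff_iter0 expr0 mul1r.
rewrite diff_iterSr //; apply: (le_trans (IH _ _ (gX _ Xx))).
rewrite exprSr -mulrA; apply: ler_wpM2l; first exact: exprn_ge0.
exact: hL.
Qed.

Lemma small_power {R : realType} (C l e : R) : 0 <= l < 1 -> 0 < e ->
  exists n, C * l ^+ n <= e.
Proof.
move=> /andP[l0 l1] e0.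
have cv : (C * l ^+ n) @[n --> \oo] --> C * 0.
  by apply: cvgMr; apply: cvg_expr; rewrite ger0_norm.
rewrite mulr0 in cv.
move/cvgrPdist_le: cv => /(_ e e0) [n _ Hn].
exists n; have := Hn n (leqnn n) => /=; rewrite sub0r normrN.
exact/le_trans/ler_norm.
Qed.

(** Stable and unstable vectors are uniformly transverse: an iterate [n] with
    [C * l ^+ n <= 1 / 2] separates them, whereas it stretches their difference at
    most by [L ^+ n]. *)
Lemma hyperbolic_angle {R : realType} (g : 'rV[R]_2 -> 'rV[R]_2)
    (X : set 'rV[R]_2) (Es Eu : 'rV[R]_2 -> {vspace 'rV[R]_2}) (C l L : R) :
  (forall x, differentiable g x) -> (forall x, X x -> X (g x)) -> 0 <= L ->
  (forall x v, X x -> `|'d g x v| <= L * `|v|) ->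
  0 < C -> 0 < l < 1 ->
  (forall x, X x ->
    (forall n v, v \in Es x -> `|'d (iter n g) x v| <= C * l ^+ n * `|v|) /\
    (forall n v, v \in Eu x -> `|v| <= C * l ^+ n * `|'d (iter n g) x v|)) ->
  exists2 Q, 1 <= Q & forall x u s, X x -> u \in Eu x -> s \in Es x ->
    `|u| <= Q * `|u - s|.
Proof.
move=> dg gX L0 hL C0 /andP[l0 l1] hyp.
have [||n hn] := @small_power R C l (2^-1); rewrite ?invr_gt0 ?(ltW l0) ?l1 //.
exists (L ^+ n + 1); first by rewrite lerDr exprn_ge0.
move=> x u s Xx uE sE; have [hs hu] := hyp x Xx.
have := hs n _ sE; have := hu n _ uE.
have := @diff_iter_bound _ g X L n x (u - s) dg gX L0 hL Xx.
rewrite linearB /=.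
set Du := 'd (iter n g) x u; set Ds := 'd (iter n g) x s.
set c := C * l ^+ n in hn *.
have := ler_normD (Du - Ds) Ds; rewrite subrK.
have := ler_normB u (u - s); rewrite opprB addrC subrK.
move: (normr_ge0 u) (normr_ge0 s) (normr_ge0 Du) (normr_ge0 Ds) (normr_ge0 (u - s)).
move: `|u| `|s| `|Du| `|Ds| `|u - s| `|Du - Ds| (L ^+ n) => a b p q r w Ln.
move=> a0 b0 p0 q0 r0 hb hp hw ha hq.
have c0 : 0 <= c by rewrite /c mulr_ge0 ?exprn_ge0 // ltW.
have : c * p <= 2^-1 * p by apply: ler_wpM2r.
have : c * b <= 2^-1 * b by apply: ler_wpM2r.
lra.
Qed.

(** The unit vector for the adapted unstable norm
    [|v|' = inf_n l ^ n |d(g ^ n) v|], which one iteration of [g] multiplies by at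
    least [1 / l] (shift the index in the infimum). *)
Lemma unit_unstable {R : realType} (g : 'rV[R]_2 -> 'rV[R]_2)
    (x u : 'rV[R]_2) (C l : R) :
  0 < C -> 0 < l < 1 -> u != 0 ->
  (forall n t, `|t *: u| <= C * l ^+ n * `|'d (iter n g) x (t *: u)|) ->
  exists2 t, t != 0 &
    inf (range (fun n => l ^+ n * `|'d (iter n g) x (t *: u)|)) = 1.
Proof.
move=> C0 /andP[l0 l1] u0 hu.
pose F n := l ^+ n * `|'d (iter n g) x u|.
have F0 n : 0 <= F n by apply: mulr_ge0 => //; exact/exprn_ge0/ltW.
have I0 : 0 < inf (range F).
  apply: (@lt_le_trans _ _ (`|u| / C)); first by rewrite divr_gt0 ?normr_gt0.
  apply: lb_le_inf; first by exists (F 0%N), 0%N.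
  move=> _ [n _ <-]; rewrite ler_pdivrMr // /F.
  by have := hu n 1; rewrite scale1r; lra.
exists (inf (range F))^-1; first by rewrite invr_neq0 ?gt_eqF.
have -> : (fun n => l ^+ n * `|'d (iter n g) x ((inf (range F))^-1 *: u)|) =
    (fun n => (inf (range F))^-1 * F n).
  apply/funext => n; rewrite linearZ /= normrZ ger0_norm ?invr_ge0 1?ltW //.
  by rewrite /F; ring.
by rewrite inf_scale ?invr_gt0 // mulVf // gt_eqF.
Qed.

(** The unit vector for the adapted stable norm [|v|' = sup_n l ^ - n |d(g ^ n) v|],
    which one iteration of [g] multiplies by at most [l]. *)
Lemma unit_stable {R : realType} (g : 'rV[R]_2 -> 'rV[R]_2)
    (x u : 'rV[R]_2) (C l : R) :
  0 < C -> 0 < l < 1 -> u != 0 ->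
  (forall n t, `|'d (iter n g) x (t *: u)| <= C * l ^+ n * `|t *: u|) ->
  exists2 t, t != 0 &
    sup (range (fun n => l ^- n * `|'d (iter n g) x (t *: u)|)) = 1.
Proof.
move=> C0 /andP[l0 l1] u0 hu.
pose F n := l ^- n * `|'d (iter n g) x u|.
have hF : has_ubound (range F).
  exists (C * `|u|) => _ [n _ <-]; rewrite /F mulrC ler_pdivrMr ?exprn_gt0 //.
  by have := hu n 1; rewrite scale1r; lra.
have I0 : 0 < sup (range F).
  apply: (@lt_le_trans _ _ `|u|); first by rewrite normr_gt0.
  apply: ub_le_sup => //; exists 0%N => //.
  by rewrite /F diff_iter0 expr0 invr1 mul1r.
exists (sup (range F))^-1; first by rewrite invr_neq0 ?gt_eqF.
have -> : (fun n => l ^- n * `|'d (iter n g) x ((sup (range F))^-1 *: u)|) =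
    (fun n => (sup (range F))^-1 * F n).
  apply/funext => n; rewrite linearZ /= normrZ ger0_norm ?invr_ge0 1?ltW //.
  by rewrite /F; ring.
by rewrite sup_scale ?invr_gt0 // mulVf // gt_eqF.
Qed.

Lemma adapted_frame_exists {R : realType} (g : 'rV[R]_2 -> 'rV[R]_2)
    (X : set 'rV[R]_2) (Es Eu : 'rV[R]_2 -> {vspace 'rV[R]_2}) (C l L : R) :
  (forall x, differentiable g x) -> (forall x, X x -> X (g x)) -> 0 <= L ->
  (forall x v, X x -> `|'d g x v| <= L * `|v|) ->
  0 < C -> 0 < l < 1 ->
  (forall z, X z ->
    [/\ (Es z + Eu z)%VS = fullv /\ (Es z :&: Eu z)%VS = 0%VS,
        [set 'd g z v | v in [set v | v \in Es z]] = [set v | v \in Es (g z)],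
        [set 'd g z v | v in [set v | v \in Eu z]] = [set v | v \in Eu (g z)],
        forall n v, v \in Es z -> `|'d (iter n g) z v| <= C * l ^+ n * `|v| &
        forall n v, v \in Eu z -> `|v| <= C * l ^+ n * `|'d (iter n g) z v|]) ->
  exists Q e f A B, 1 <= Q /\
    adapted_frame g (X `&` split_at g Es Eu) l Q e f A B.
Proof.
move=> dg gX L0 hL C0 l01 hyp.
have l0 : 0 < l by case/andP: l01.
have [|Q1 Q11 angle] := @hyperbolic_angle R g X Es Eu C l L dg gX L0 hL C0 l01.
  by move=> x /hyp[].
pose nu x v := inf (range (fun n => l ^+ n * `|'d (iter n g) x v|)).
pose ns x v := sup (range (fun n => l ^- n * `|'d (iter n g) x v|)).
set X1 := X `&` split_at g Es Eu.
have gX1 x : X1 x -> X1 (g x).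
  by move=> [Xx Sx]; split; [exact: gX|move=> k; rewrite -iterSr; exact: Sx].
have /(@boolp.choice _ _ (fun x v => X1 x -> v \in Eu x /\ nu x v = 1)) [e he] :
    forall x, exists v, X1 x -> v \in Eu x /\ nu x v = 1.
    move=> x; have [[Xx Sx]|nX] := pselect (X1 x); last by exists 0.
    have [[u uE u0] _] := Sx 0%N; have [_ _ _ _ hu] := hyp x Xx.
    have [|t t0 ht] := @unit_unstable R g x u C l C0 l01 u0.
      by move=> n t; apply: hu; rewrite rpredZ.
    by exists (t *: u); split => //; rewrite rpredZ.
have /(@boolp.choice _ _ (fun x v => X1 x -> v \in Es x /\ ns x v = 1)) [f hf] :
    forall x, exists v, X1 x -> v \in Es x /\ ns x v = 1.
    move=> x; have [[Xx Sx]|nX] := pselect (X1 x); last by exists 0.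
    have [_ [u uE u0]] := Sx 0%N; have [_ _ _ hs _] := hyp x Xx.
    have [|t t0 ht] := @unit_stable R g x u C l C0 l01 u0.
      by move=> n t; apply: hs; rewrite rpredZ.
    by exists (t *: u); split => //; rewrite rpredZ.
have lbF x v : has_lbound (range (fun n => l ^+ n * `|'d (iter n g) x v|)).
  by exists 0 => _ [n _ <-]; apply: mulr_ge0 => //; exact/exprn_ge0/ltW.
have ubF x v : X1 x -> v \in Es x ->
    ubound (range (fun n => l ^- n * `|'d (iter n g) x v|)) (C * `|v|).
  move=> [Xx _] vE _ [n _ <-]; rewrite mulrC ler_pdivrMr ?exprn_gt0 //.
  by have [_ _ _ /(_ n v vE)] := hyp x Xx; lra.
have e1 x : X1 x -> 1 <= `|e x| <= C.
  move=> X1x; have [eE ne] := he x X1x; have [_ _ _ _ hu] := hyp x X1x.1.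
  rewrite -{1}ne; apply/andP; split.
    by apply: ge_inf => //; exists 0%N => //; rewrite diff_iter0 expr0 mul1r.
  rewrite -[C]mulr1 -ne mulrC -ler_pdivrMr //; apply: lb_le_inf.
    by eexists; exists 0%N.
  by move=> _ [n _ <-]; rewrite ler_pdivrMr //; have := hu n _ eE; lra.
have f1 x : X1 x -> C^-1 <= `|f x| <= 1.
  move=> X1x; have [fE nf] := hf x X1x.
  rewrite -{1}nf; apply/andP; split.
    rewrite -[C^-1]mulr1 -nf mulrC ler_pdivrMr // mulrC; apply: ge_sup.
      by eexists; exists 0%N.
    exact: ubF.
  apply: ub_le_sup; first by eexists; exact: ubF.
  by exists 0%N => //; rewrite diff_iter0 expr0 invr1 mul1r.
have e0 x : X1 x -> e x != 0.
  by move=> /e1/andP[h _]; rewrite -normr_gt0 (lt_le_trans _ h).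
have f0 x : X1 x -> f x != 0.
  by move=> /f1/andP[h _]; rewrite -normr_gt0 (lt_le_trans _ h) ?invr_gt0.
have cap x : X1 x -> (Eu x :&: Es x)%VS = 0%VS.
  by move=> [/hyp[[_ h] _ _ _ _] _]; rewrite capvC.
have d0 x : X1 x -> det2 (e x) (f x) != 0.
  move=> X1x; apply: (@det2_neq0 _ (Eu x) (Es x)); rewrite ?cap ?e0 ?f0 //.
    exact: (he x X1x).1.
  exact: (hf x X1x).1.
pose A x := crd1 (e (g x)) (f (g x)) ('d g x (e x)).
pose B x := crd2 (e (g x)) (f (g x)) ('d g x (f x)).
have dA x : X1 x -> 'd g x (e x) = A x *: e (g x).
  move=> X1x; have X1g := gX1 _ X1x.
  apply: (@eigenline _ (Eu (g x)) (Es (g x)) _ _ _ _ _ _ _ _).1;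
    rewrite ?cap ?e0 ?f0 ?(he _ X1g).1 ?(hf _ X1g).1 //.
  have [_ _ h _ _] := hyp x X1x.1.
  suff: [set v | v \in Eu (g x)] ('d g x (e x)) by [].
  by rewrite -h; exists (e x) => //; exact: (he x X1x).1.
have dB x : X1 x -> 'd g x (f x) = B x *: f (g x).
  move=> X1x; have X1g := gX1 _ X1x.
  apply: (@eigenline _ (Eu (g x)) (Es (g x)) _ _ _ _ _ _ _ _).2;
    rewrite ?cap ?e0 ?f0 ?(he _ X1g).1 ?(hf _ X1g).1 //.
  have [_ h _ _ _] := hyp x X1x.1.
  suff: [set v | v \in Es (g x)] ('d g x (f x)) by [].
  by rewrite -h; exists (f x) => //; exact: (hf x X1x).1.
clearbody A B.
exists ((C + 1) * (Q1 + 1)), e, f, A, B; split; first by nra.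
split.
- exact: d0.
- move=> x v X1x; rewrite {1 3}(crdK v (d0 x X1x)) linearD !linearZ /=.
  rewrite dA // dB // !scalerA; have [-> ->] := crd_comb
    (crd1 (e x) (f x) v * A x) (crd2 (e x) (f x) v * B x) (d0 _ (gX1 _ X1x)).
  by split; rewrite mulrC.
- move=> x X1x; have X1g := gX1 _ X1x; split.
    have [_ ne] := he x X1x; have [_ neg] := he _ X1g.
    apply: (@le_trans _ _ (nu (g x) (A x *: e (g x)))).
      rewrite -dA //; apply: lb_le_inf; first by eexists; exists 0%N.
      move=> _ [n _ <-]; rewrite -diff_iterSr // -[_^-1]mulr1 -ne mulrC.
      rewrite ler_pdivrMr // mulrC mulrA -exprS; exact: ge_inf.
    have [A0|A0] := eqVneq (A x) 0.
      rewrite A0 scale0r normr0; apply: (@le_trans _ _ (l ^+ 0 * `|'d (iter 0 g) (g x) 0|)).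
        by apply: ge_inf => //; exists 0%N.
      by rewrite linear0 normr0 mulr0.
    rewrite -[`|A x|]mulr1 -neg /nu -inf_scale ?normr_gt0 //; last first.
      by move=> n; apply: mulr_ge0 => //; exact/exprn_ge0/ltW.
    apply: lb_le_inf; first by eexists; exists 0%N.
    move=> _ [n _ <-].
    have -> : `|A x| * (l ^+ n * `|'d (iter n g) (g x) (e (g x))|) =
        l ^+ n * `|'d (iter n g) (g x) (A x *: e (g x))|.
      by rewrite linearZ /= normrZ mulrCA.
    by apply: ge_inf => //; exists n.
  have [_ nf] := hf x X1x; have [fgE nfg] := hf _ X1g.
  rewrite -[`|B x|]mulr1 -nfg -[l]mulr1 -nf /ns.
  have [B0|B0] := eqVneq (B x) 0.
    rewrite B0 normr0 mul0r mulr_ge0 ?(ltW l0) //.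
    by have := nf; rewrite /ns => ->.
  rewrite -sup_scale ?normr_gt0 //; last by eexists; exact: ubF.
  apply: ge_sup; first by eexists; exists 0%N.
  move=> _ [n _ <-].
  have -> : `|B x| * (l ^- n * `|'d (iter n g) (g x) (f (g x))|) =
      l ^- n * `|'d (iter n.+1 g) x (f x)|.
    have E : 'd (iter n.+1 g) x (f x) = B x *: 'd (iter n g) (g x) (f (g x)).
      apply: (eq_trans (@diff_iterSr _ g n x (f x) dg)).
      apply: (eq_trans (congr1 ('d (iter n g) (g x)) (dB x X1x))).
      exact: linearZ.
    rewrite mulrCA; congr (_ * _).
    exact: (eq_trans (esym (normrZ _ _)) (congr1 Num.norm (esym E))).
  rewrite -ler_pdivrMl // mulrA -invfM -exprS.
  apply: ub_le_sup; first by have [fE _] := hf x X1x; eexists; exact: ubF.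
  by exists n.+1.
- move=> x v X1x; set a := crd1 _ _ v; set b := crd2 _ _ v.
  have vE : v = a *: e x + b *: f x := crdK v (d0 x X1x).
  clearbody a b.
  have /andP[e1x e2x] := e1 x X1x; have /andP[f1x f2x] := f1 x X1x.
  have h1 : `|a *: e x| <= Q1 * `|v|.
    have := angle x (a *: e x) (- b *: f x) X1x.1.
    rewrite scaleNr opprK -vE; apply.
      by rewrite rpredZ // (he x X1x).1.
    by rewrite -scaleNr rpredZ // (hf x X1x).1.
  have h2 : `|b *: f x| <= (Q1 + 1) * `|v|.
    have := ler_normB v (a *: e x); rewrite {1}vE addrC addKr.
    lra.
  have v0 := normr_ge0 v; have a0 := normr_ge0 a; have b0 := normr_ge0 b.
  split.
  + rewrite normrZ in h1.
    have : `|a| * 1 <= `|a| * `|e x| by apply: ler_wpM2l.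
    have : Q1 * `|v| <= (C + 1) * (Q1 + 1) * `|v| by apply: ler_wpM2r => //; nra.
    lra.
  + rewrite normrZ in h2.
    have : `|b| / C <= `|b| * `|f x| by apply: ler_wpM2l.
    move=> h3; have : `|b| / C <= (Q1 + 1) * `|v| by lra.
    rewrite ler_pdivrMr // => h4.
    have : C * (Q1 + 1) * `|v| <= (C + 1) * (Q1 + 1) * `|v|.
      by apply: ler_wpM2r => //; nra.
    lra.
  + have am : `|a| <= Num.max `|a| `|b| by rewrite le_max lexx.
    have bm : `|b| <= Num.max `|a| `|b| by rewrite le_max lexx orbT.
    have := ler_normD (a *: e x) (b *: f x); rewrite -vE !normrZ.
    set m := Num.max _ _ in am bm *.
    have m0 : 0 <= m by lra.
    have : `|a| * `|e x| <= m * C by apply: ler_pM.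
    have : `|b| * `|f x| <= m * 1 by apply: ler_pM.
    have : (C + 1) * m <= (C + 1) * (Q1 + 1) * m by apply: ler_wpM2r => //; nra.
    lra.
- by move=> x /e1/andP[_ h]; nra.
Qed.

(** * Pieces of a segment that shadow a periodic orbit *)

Lemma sum_disjoint_lengths {R : realType} {T : choiceType} (xs : seq T)
    (c d : T -> R) (a b : R) :
  uniq xs -> a <= b ->
  (forall x, x \in xs -> [/\ a <= c x, c x <= d x & d x <= b]) ->
  (forall x y t, x \in xs -> y \in xs -> c x <= t <= d x -> c y <= t <= d y ->
     x = y) ->
  \sum_(x <- xs) (d x - c x) <= b - a.
Proof.
move=> uxs ab hcd disj; rewrite -lee_fin -sumEFin.
pose F x := `[c x, d x]%classic : set R.
have FE x : x \in xs -> lebesgue_measure (F x) = (d x - c x)%:E.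
  move=> xs_x; rewrite /F lebesgue_measure_itv /= lte_fin.
  have [_ h _] := hcd x xs_x; case: ltP => // h'.
  by have -> : d x = c x; [apply/eqP; rewrite eq_le h' h|rewrite subrr].
have -> : (\sum_(x <- xs) (d x - c x)%:E)%E =
    (\sum_(x \in [set` xs]) lebesgue_measure (F x))%E.
  by rewrite -fsbig_seq //; apply: eq_big_seq => x /FE ->.
rewrite -measure_fin_bigcup //; last 2 first.
- by move=> x y /= xx yy [t [/=]]; rewrite /F /= !in_itv /=; exact: disj.
- by move=> x _; exact: measurable_itv.
apply: (@le_trans _ _ (lebesgue_measure (`[a, b]%classic : set R))).
  apply: le_measure; rewrite ?inE //=.
    by apply: fin_bigcup_measurable => // x _; exact: measurable_itv.
  move=> t [x /= xx]; rewrite /F /= !in_itv /= => /andP[h1 h2].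
  by have [h3 _ h4] := hcd x xx; rewrite (le_trans h3 h1) (le_trans h2 h4).
rewrite lebesgue_measure_itv /= lte_fin; case: ifP => // _.
by rewrite lee_fin subr_ge0.
Qed.

(** A uniform second-order Taylor bound, for maps with globally bounded second
    derivatives. *)
Definition quad_approx {R : realType} (c : R) (g : 'rV[R]_2 -> 'rV[R]_2) : Prop :=
  forall z w w', `|g w - g w' - 'd g z (w - w')| <=
    c * Num.max `|w - z| `|w' - z| * `|w - w'|.

(** The link between vectors that nearly follow the derivative of [g] along an
    orbit and scalar recursions; it serves for tangent vectors of nearby maps as
    well as for differences of nearby orbits. *)
Lemma frame_almost_split {R : realType} (g : 'rV[R]_2 -> 'rV[R]_2)
    (X : set 'rV[R]_2) (l Q eta : R) (e f : 'rV[R]_2 -> 'rV[R]_2)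
    (A B : 'rV[R]_2 -> R) (x : 'rV[R]_2) (n : nat) (w : nat -> 'rV[R]_2) :
  adapted_frame g X l Q e f A B -> 0 <= Q -> 0 <= eta ->
  (forall k, X (iter k g x)) ->
  (forall k, (k < n)%N ->
     `|w k.+1 - 'd g (iter k g x) (w k)| <= eta * `|w k|) ->
  almost_split n (fun k => A (iter k g x)) (fun k => B (iter k g x))
    (Q * eta * Q)
    (fun k => crd1 (e (iter k g x)) (f (iter k g x)) (w k))
    (fun k => crd2 (e (iter k g x)) (f (iter k g x)) (w k)).
Proof.
move=> fr Q0 eta0 Xx hw k kn.
have Xk := Xx k; have Xk1 := Xx k.+1; rewrite iterS in Xk1.
have [d1 d2] := frame_dyn fr (w k) Xk.
have [_ _ b3] := frame_crd fr (w k) Xk.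
have [h1 h2 _] := frame_crd fr (w k.+1 - 'd g (iter k g x) (w k)) Xk1.
have sub (c : 'rV[R]_2 -> 'rV[R]_2 -> 'rV[R]_2 -> R) e' f' u v :
    (forall e f v w t, c e f (t *: v + w) = t * c e f v + c e f w) ->
    c e' f' (u - v) = c e' f' u - c e' f' v.
  by move=> lin; rewrite addrC -scaleN1r lin mulN1r addrC.
rewrite (sub (@crd1 R) _ _ _ _ (@crd1_lin R)) d1 in h1.
rewrite (sub (@crd2 R) _ _ _ _ (@crd2_lin R)) d2 in h2.
have H : Q * `|w k.+1 - 'd g (iter k g x) (w k)| <=
    Q * eta * Q * Num.max `|crd1 (e (iter k g x)) (f (iter k g x)) (w k)|
       `|crd2 (e (iter k g x)) (f (iter k g x)) (w k)|.
  apply: (@le_trans _ _ (Q * (eta * `|w k|))).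
    by apply: ler_wpM2l => //; exact: hw.
  by rewrite -!mulrA; do 2 apply: ler_wpM2l => //.
by rewrite iterS; split; [exact: (le_trans h1)|exact: (le_trans h2)].
Qed.

Lemma crd1_continuous {R : realType} (e f : 'rV[R]_2) : continuous (crd1 e f).
Proof.
have cc i : continuous (fun v : 'rV[R]_2 => v 0 i) by exact: coord_continuous.
have ck (k : R) : continuous (fun _ : 'rV[R]_2 => k) by exact: cst_continuous.
move=> v; rewrite /crd1 /det2.
apply: (@continuousM _ _ (fun v : 'rV[R]_2 => v 0 0 * f 0 1 - v 0 1 * f 0 0)
  (fun=> (e 0 0 * f 0 1 - e 0 1 * f 0 0)^-1)); last exact: ck.
apply: (@continuousB _ _ _ (fun v : 'rV[R]_2 => v 0 0 * f 0 1)
  (fun v : 'rV[R]_2 => v 0 1 * f 0 0)).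
  by apply: (@continuousM _ _ (fun v : 'rV[R]_2 => v 0 0) (fun=> f 0 1));
    [exact: cc|exact: ck].
by apply: (@continuousM _ _ (fun v : 'rV[R]_2 => v 0 1) (fun=> f 0 0));
  [exact: cc|exact: ck].
Qed.

(** The segment [t |-> y + t v] crosses the box around [x] since [y] and [v] are
    close to [x] and [e x], so [nested_crossings] gives a piece [[a, b]] that stays
    within [Q * rho] of the orbit of [x].  Its image under [g ^ n] crosses the last
    box, hence has length at least [2 * rho], and two orbits in the piece separate
    at most at the rate [|A_k| + eps] ([almost_split_growth]). *)
Lemma shadowing_interval {R : realType} (g : 'rV[R]_2 -> 'rV[R]_2)
    (X : set 'rV[R]_2) (l Q c eps rho kap : R) (e f : 'rV[R]_2 -> 'rV[R]_2)
    (A B : 'rV[R]_2 -> R) (x y v : 'rV[R]_2) (n : nat) :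
  adapted_frame g X l Q e f A B -> 1 <= Q -> 0 <= c ->
  (forall x, differentiable g x) -> quad_approx c g ->
  0 < l < 1 -> 0 < eps -> 1 + eps <= l^-1 -> l + eps <= 1 ->
  0 < rho -> Q * (c * (Q * rho)) * Q <= eps ->
  (forall k, X (iter k g x)) ->
  `|x - y| <= kap -> `|e x - v| <= kap -> `|v| <= Q ->
  Q * (kap + 2 * rho * kap) <= rho ->
  exists a b, [/\ - (2 * rho) <= a, a <= b, b <= 2 * rho,
    forall k t, (k <= n)%N -> a <= t <= b ->
      `|iter k g (y + t *: v) - iter k g x| <= Q * rho &
    2 * rho <= (\prod_(k < n) (`|A (iter k g x)| + eps)) * (Q ^+ 2 * (b - a))].
Proof.
move=> fr Q1 c0 dg qg /andP[l0 l1] eps0 le1 le2 rho0 hrho Xx hx hv vQ hkap.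
have Q0 : 0 <= Q by lra.
pose w k t := iter k g (y + t *: v) - iter k g x.
pose u k t := crd1 (e (iter k g x)) (f (iter k g x)) (w k t).
pose s k t := crd2 (e (iter k g x)) (f (iter k g x)) (w k t).
have rate k : 1 + eps <= `|A (iter k g x)| /\ `|B (iter k g x)| <= l.
  by have [h1 h2] := frame_rate fr (Xx k); split => //; lra.
have wle k t : `|u k t| <= rho -> `|s k t| <= rho -> `|w k t| <= Q * rho.
  move=> h1 h2; have [_ _ h] := frame_crd fr (w k t) (Xx k).
  by apply: (le_trans h); apply: ler_wpM2l => //; rewrite ge_max h1 h2.
have X0 := Xx 0%N; rewrite /= in X0.
have wE t : w 0%N t = t *: e x + ((y - x) - t *: (e x - v)).
  by rewrite /w /= scalerBr; apply: row2P; rewrite !mxE; ring.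
have r0 t : `|t| <= 2 * rho -> `|(y - x) - t *: (e x - v)| <= kap + 2 * rho * kap.
  move=> ht; apply: (le_trans (ler_normB _ _)); rewrite distrC normrZ.
  by apply: lerD => //; apply: ler_pM.
have crde : crd1 (e x) (f x) (e x) = 1 /\ crd2 (e x) (f x) (e x) = 0.
  have := @crd_comb _ (e x) (f x) 1 0 (frame_det fr X0).
  by rewrite scale1r scale0r addr0.
have u0E t : u 0%N t = t + crd1 (e x) (f x) ((y - x) - t *: (e x - v)).
  by rewrite /u wE /= crd1_lin crde.1 mulr1.
have s0E t : s 0%N t = crd2 (e x) (f x) ((y - x) - t *: (e x - v)).
  by rewrite /s wE /= crd2_lin crde.2 mulr0 add0r.
have small t : `|t| <= 2 * rho ->
    `|crd1 (e x) (f x) ((y - x) - t *: (e x - v))| <= rho /\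
    `|crd2 (e x) (f x) ((y - x) - t *: (e x - v))| <= rho.
  move=> /r0 h; have [h1 h2 _] := frame_crd fr ((y - x) - t *: (e x - v)) X0.
  have := ler_wpM2l Q0 h.
  by split; lra.
have hQ : 0 <= c * (Q * rho) by rewrite mulr_ge0 // mulr_ge0 // ltW.
have cz : continuous (fun t : R => y + t *: v).
  move=> t; apply: (@cvgD _ _ _ _ _ (fun=> y) (fun t => t *: v)).
    exact: cst_continuous.
  exact: scalel_continuous.
have cg k : continuous (fun t : R => iter k g (y + t *: v)).
  move=> t; apply: (@continuous_comp R 'rV[R]_2 'rV[R]_2 (fun t : R => y + t *: v) (iter k g)).
    exact: cz.
  exact/differentiable_continuous/differentiable_iter.
have [||||||||||a [b [ha ab hb cr H]]] := @nested_crossings R n u s (fun k => A (iter k g x))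
  (fun k => B (iter k g x)) eps l rho (- (2 * rho)) (2 * rho).
- by lra.
- by lra.
- by lra.
- by lra.
- by move=> k _; exact: rate.
- move=> k t; apply: (@continuous_comp R 'rV[R]_2 R (w k) (crd1 _ _));
    last exact: crd1_continuous.
  rewrite /w /continuous_at.
  apply: (@cvgB _ _ _ _ _ (fun t => iter k g (y + t *: v)) (fun=> iter k g x));
    last exact: cst_continuous.
  exact: cg.
- rewrite u0E; have [|+ _] := small (- (2 * rho)).
    by rewrite normrN ger0_norm //; lra.
  by rewrite ler_norml => /andP[]; lra.
- rewrite u0E; have [|+ _] := small (2 * rho).
    by rewrite ger0_norm //; lra.
  by rewrite ler_norml => /andP[]; lra.
- move=> t ht; rewrite s0E; apply: (small t _).2; rewrite ler_norml; lra.
- move=> k t kn hu hs.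
  have hw := wle _ _ hu hs.
  have Xj j : X (iter j g (iter k g x)) by rewrite -iterD.
  have [|h1 h2] := @frame_almost_split R g X l Q (c * (Q * rho)) e f A B
     (iter k g x) 1 (fun j => w (j + k)%N t) fr Q0 hQ Xj _ 0%N isT.
    move=> j; rewrite ltnS leqn0 => /eqP -> /=; rewrite add1n add0n /w !iterS.
    have := qg (iter k g x) (iter k g (y + t *: v)) (iter k g x).
    rewrite subrr normr0 => h; apply: (le_trans h); apply: ler_wpM2r => //.
    by apply: ler_wpM2l => //; rewrite ge_max; apply/andP; split => //;
      rewrite mulr_ge0 // ltW.
  move: h1 h2; rewrite /= add1n add0n -/(w k.+1 t) -/(w k t) => h1 h2.
  have M0 : Num.max `|u k t| `|s k t| <= rho by rewrite ge_max hu hs.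
  have M1 : 0 <= Num.max `|u k t| `|s k t| by rewrite le_max normr_ge0.
  have M2 : Q * (c * (Q * rho)) * Q * Num.max `|u k t| `|s k t| <= eps * rho.
    by apply: ler_pM => //; apply: mulr_ge0 => //; exact: mulr_ge0.
  by split; [apply: le_trans M2; exact: h1|apply: le_trans M2; exact: h2].
exists a, b; split => //.
  by move=> k t kn ht; have [h1 h2] := H k t kn ht; exact: wle.
pose z t := y + t *: v.
have aab : a <= a <= b by rewrite lexx.
have bab : a <= b <= b by rewrite lexx andbT.
have Xab t : a <= t <= b -> forall k, (k <= n)%N -> `|w k t| <= Q * rho.
  by move=> ht k kn; have [h1 h2] := H k t kn ht; exact: wle.
have hstep k : (k < n)%N ->
    `|(iter k.+1 g (z b) - iter k.+1 g (z a)) -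
      'd g (iter k g x) (iter k g (z b) - iter k g (z a))| <=
    c * (Q * rho) * `|iter k g (z b) - iter k g (z a)|.
  move=> kn; rewrite !iterS.
  apply: (le_trans (qg (iter k g x) (iter k g (z b)) (iter k g (z a)))).
  apply: ler_wpM2r => //; apply: ler_wpM2l => //; rewrite ge_max.
  by rewrite (Xab b bab k (ltnW kn)) (Xab a aab k (ltnW kn)).
have as2 := @frame_almost_split R g X l Q (c * (Q * rho)) e f A B x n
   (fun k => iter k g (z b) - iter k g (z a)) fr Q0 hQ Xx hstep.
have hAB k : (k < n)%N -> `|B (iter k g x)| <= `|A (iter k g x)|.
  by move=> _; have := rate k; lra.
have eps1 : 0 <= Q * (c * (Q * rho)) * Q by apply: mulr_ge0 => //; apply: mulr_ge0.
have gr := almost_split_growth eps1 hAB as2.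
have sub (d : 'rV[R]_2 -> 'rV[R]_2 -> 'rV[R]_2 -> R) e' f' p q r :
    (forall e f v w t, d e f (t *: v + w) = t * d e f v + d e f w) ->
    d e' f' (p - q) = d e' f' (p - r) - d e' f' (q - r).
  move=> lin; have -> : p - q = (-1) *: (q - r) + (p - r).
    by rewrite scaleN1r; apply: row2P; rewrite !mxE; ring.
  by rewrite lin; ring.
have step : Num.max `|crd1 (e x) (f x) (z b - z a)| `|crd2 (e x) (f x) (z b - z a)|
    <= Q ^+ 2 * (b - a).
  have -> : z b - z a = (b - a) *: v.
    by rewrite /z; apply: row2P; rewrite !mxE; ring.
  have [h1 h2 _] := frame_crd fr ((b - a) *: v) X0.
  have h3 : Q * `|(b - a) *: v| <= Q ^+ 2 * (b - a).
    rewrite normrZ ger0_norm ?subr_ge0 // expr2 -mulrA; apply: ler_wpM2l => //.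
    by rewrite mulrC; apply: ler_wpM2r => //; rewrite subr_ge0.
  by rewrite ge_max !(le_trans _ h3).
have cross : 2 * rho <= `|crd1 (e (iter n g x)) (f (iter n g x))
    (iter n g (z b) - iter n g (z a))|.
  rewrite (sub (@crd1 R) _ _ _ _ (iter n g x) (@crd1_lin R)).
  rewrite -/(w n b) -/(w n a) -/(u n b) -/(u n a).
  case: cr => -[-> ->]; clear -rho0.
    by rewrite opprK ger0_norm; lra.
  by rewrite ler0_norm; lra.
apply: (le_trans cross).
have P0 : forall k, (k < n)%N -> 0 <= `|A (iter k g x)| + Q * (c * (Q * rho)) * Q.
  by move=> k _; rewrite addr_ge0.
apply: (@le_trans _ _ ((\prod_(k < n) (`|A (iter k g x)| + Q * (c * (Q * rho)) * Q)) *
   (Q ^+ 2 * (b - a)))).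
  apply: (@le_trans _ _ ((\prod_(k < n) (`|A (iter k g x)| + Q * (c * (Q * rho)) * Q)) *
     Num.max `|crd1 (e x) (f x) (z b - z a)| `|crd2 (e x) (f x) (z b - z a)|)).
    by apply: le_trans gr; rewrite le_max lexx.
  by apply: ler_wpM2l => //; apply: prodr_ge0 => k _; exact: P0.
apply: ler_wpM2r.
  by apply: mulr_ge0; rewrite ?sqr_ge0 ?subr_ge0.
by apply: ler_prod => k _; rewrite P0 //= lerD2l.
Qed.

(** * Sums over the periodic points of a hyperbolic set *)

Lemma almost_split_le {R : realType} (n : nat) (A B : nat -> R) (e e' : R)
    (u v : nat -> R) :
  e <= e' -> almost_split n A B e u v -> almost_split n A B e' u v.
Proof.
move=> ee' h k kn; have [h1 h2] := h k kn.
have M0 : 0 <= Num.max `|u k| `|v k| by rewrite le_max normr_ge0.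
by split; [apply: (le_trans h1)|apply: (le_trans h2)]; apply: ler_wpM2r.
Qed.

(** [w] is the orbit of an eigenvector, with eigenvalue [s], under linear maps
    close to the derivatives of [g] along the cycle. *)
Lemma frame_multiplier {R : realType} (g : 'rV[R]_2 -> 'rV[R]_2)
    (X : set 'rV[R]_2) (l Q eta eps s : R) (e f : 'rV[R]_2 -> 'rV[R]_2)
    (A B : 'rV[R]_2 -> R) (x : 'rV[R]_2) (p : nat) (w : nat -> 'rV[R]_2) :
  adapted_frame g X l Q e f A B -> 0 <= Q -> 0 <= eta ->
  (forall k, X (iter k g x)) -> (0 < p)%N -> iter p g x = x ->
  0 < l -> 1 + eps <= l^-1 -> l + eps < 1 -> Q * eta * Q <= eps ->
  (forall k, (k < p)%N ->
     `|w k.+1 - 'd g (iter k g x) (w k)| <= eta * `|w k|) ->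
  w p = s *: w 0%N -> w 0%N != 0 -> 1 <= `|s| ->
  \prod_(k < p) (`|A (iter k g x)| - eps) <= `|s|.
Proof.
move=> fr Q0 eta0 Xx p0 px l0 le1 le2 hQ hw wp w0 s1.
have eps0 : 0 <= eps.
  by apply: le_trans hQ; apply: mulr_ge0 => //; exact: mulr_ge0.
have hs := almost_split_le hQ (frame_almost_split fr Q0 eta0 Xx hw).
apply: (@cyclic_multiplier R p _ _ eps l s _ _ p0 eps0 (ltW l0) le2 _ hs _ _ s1).
- by move=> k _; have [h1 h2] := frame_rate fr (Xx k); split => //; lra.
- rewrite px wp -[s *: _]addr0 crd1_lin (_ : crd1 _ _ 0 = 0) ?addr0 //.
  by rewrite /crd1 /det2 !mxE; ring.
- rewrite px wp -[s *: _]addr0 crd2_lin (_ : crd2 _ _ 0 = 0) ?addr0 //.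
  by rewrite /crd2 /det2 !mxE; ring.
have [_ _ h] := frame_crd fr (w 0%N) (Xx 0%N).
have w0' : 0 < `|w 0%N| by rewrite normr_gt0.
rewrite ltNge; apply/negP => h'.
by have := ler_wpM2l Q0 h'; rewrite /= in h *; lra.
Qed.

Lemma frame_prod_gt1 {R : realType} (g : 'rV[R]_2 -> 'rV[R]_2)
    (X : set 'rV[R]_2) (l Q eps : R) (e f : 'rV[R]_2 -> 'rV[R]_2)
    (A B : 'rV[R]_2 -> R) (x : 'rV[R]_2) (p : nat) :
  adapted_frame g X l Q e f A B -> (forall k, X (iter k g x)) -> 0 <= l^-1 - eps ->
  (l^-1 - eps) ^+ p <= \prod_(k < p) (`|A (iter k g x)| - eps).
Proof.
move=> fr Xx le1.
have -> : (l^-1 - eps) ^+ p = \prod_(k < p) (l^-1 - eps).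
  by rewrite prodr_const card_ord.
by apply: ler_prod => k _; rewrite le1 /= lerD2r; have [] := frame_rate fr (Xx k).
Qed.

(** The difference of the two orbits is periodic, hence would be multiplied by [1]
    over a period, whereas the product of the [|A_k| - eps] exceeds one. *)
Lemma frame_expansive {R : realType} (g : 'rV[R]_2 -> 'rV[R]_2)
    (X : set 'rV[R]_2) (l Q c r eps : R) (e f : 'rV[R]_2 -> 'rV[R]_2)
    (A B : 'rV[R]_2 -> R) (x x' : 'rV[R]_2) (p : nat) :
  adapted_frame g X l Q e f A B -> 0 <= Q -> 0 <= c -> 0 <= r ->
  quad_approx c g ->
  (forall k, X (iter k g x)) -> (0 < p)%N -> iter p g x = x -> iter p g x' = x' ->
  0 < l -> 1 + eps < l^-1 -> l + eps < 1 -> Q * (c * r) * Q <= eps ->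
  (forall k, (k < p)%N -> `|iter k g x' - iter k g x| <= r) ->
  x' = x.
Proof.
move=> fr Q0 c0 r0 qg Xx p0 px px' l0 le1 le2 hQ hr.
apply/eqP; rewrite -subr_eq0; apply/negPn/negP => nz.
have cr0 : 0 <= c * r by exact: mulr_ge0.
have : \prod_(k < p) (`|A (iter k g x)| - eps) <= `|1 : R|.
  apply: (@frame_multiplier R g X l Q (c * r) eps 1 e f A B x p
    (fun k => iter k g x' - iter k g x)) => //; rewrite ?normr1 ?(ltW le1) //=.
    move=> k kn; rewrite /=.
    apply: (le_trans (qg (iter k g x) (iter k g x') (iter k g x))).
    apply: ler_wpM2r => //; apply: ler_wpM2l => //.
    by rewrite subrr normr0 ge_max r0 hr.
  by rewrite px px' scale1r.
rewrite normr1 leNgt => /negP; apply.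
have h0 : 0 <= l^-1 - eps by lra.
apply: lt_le_trans (frame_prod_gt1 p fr Xx h0).
by rewrite exprn_egt1 -?lt0n //; lra.
Qed.

(** All the points considered use the same segment through [y].  The pieces of
    the segment attached to them are disjoint, and their total length is at most
    [4 * rho]. *)
Lemma period_cell_sum {R : realType} (g : 'rV[R]_2 -> 'rV[R]_2)
    (X : set 'rV[R]_2) (l Q c eps rho kap : R) (e f : 'rV[R]_2 -> 'rV[R]_2)
    (A B : 'rV[R]_2 -> R) (y v : 'rV[R]_2) (p : nat) (xs : seq 'rV[R]_2) :
  adapted_frame g X l Q e f A B -> 1 <= Q -> 0 <= c ->
  (forall x, differentiable g x) -> quad_approx c g ->
  0 < l < 1 -> 0 < eps -> 1 + eps < l^-1 -> l + eps < 1 ->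
  0 < rho -> Q * (c * (2 * (Q * rho))) * Q <= eps ->
  `|v| <= Q -> Q * (kap + 2 * rho * kap) <= rho ->
  (0 < p)%N -> uniq xs ->
  (forall x, x \in xs -> [/\ forall k, X (iter k g x), iter p g x = x,
     `|x - y| <= kap & `|e x - v| <= kap]) ->
  \sum_(x <- xs) (\prod_(k < p) (`|A (iter k g x)| + eps))^-1 <= 2 * Q ^+ 2.
Proof.
move=> fr Q1 c0 dg qg l01 eps0 le1 le2 rho0 hQ vQ hkap p0 uxs hxs.
have Q0 : 0 <= Q by lra.
have l0 : 0 < l by case/andP: l01.
have Qr : 0 <= Q * rho by rewrite mulr_ge0 // ltW.
have hQ' : Q * (c * (Q * rho)) * Q <= eps.
  apply: le_trans hQ; apply: ler_wpM2r => //; apply: ler_wpM2l => //.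
  by apply: ler_wpM2l => //; lra.
pose P x (ab : R * R) := x \in xs -> [/\ - (2 * rho) <= ab.1, ab.1 <= ab.2,
   ab.2 <= 2 * rho,
    forall k t, (k <= p)%N -> ab.1 <= t <= ab.2 ->
      `|iter k g (y + t *: v) - iter k g x| <= Q * rho &
    2 * rho <= (\prod_(k < p) (`|A (iter k g x)| + eps)) *
               (Q ^+ 2 * (ab.2 - ab.1))].
have /(@boolp.choice _ _ P)[ab hab] : forall x, exists ab, P x ab.
  move=> x; have [xxs|nxs] := boolP (x \in xs); last first.
    by exists 0 => h; rewrite h in nxs.
  have [h1 h2 h3 h4] := hxs x xxs.
  have [a [b H]] := @shadowing_interval R g X l Q c eps rho kap e f A B x y v p
    fr Q1 c0 dg qg l01 eps0 (ltW le1) (ltW le2) rho0 hQ' h1 h3 h4 vQ hkap.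
  by exists (a, b).
have disj : \sum_(x <- xs) ((ab x).2 - (ab x).1) <= 2 * rho - - (2 * rho).
  apply: sum_disjoint_lengths => //; first lra.
    by move=> x /hab[].
  move=> x x' t xx xx' ht ht'.
  have [_ _ _ H _] := hab x xx; have [_ _ _ H' _] := hab x' xx'.
  have [Xx px _ _] := hxs x xx; have [Xx' px' _ _] := hxs x' xx'.
  apply: (@frame_expansive R g X l Q c (2 * (Q * rho)) eps e f A B x' x p) => //.
    by apply: mulr_ge0.
  move=> k kp; have := H k t (ltnW kp) ht; have := H' k t (ltnW kp) ht'.
  set z := iter k g _; set zx := iter k g x; set zy := iter k g x'.
  move=> h1 h2; have -> : zx - zy = (z - zy) - (z - zx).
    by apply: row2P; rewrite !mxE; ring.
  by apply: (le_trans (ler_normB _ _)); lra.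
have each x : x \in xs ->
    (\prod_(k < p) (`|A (iter k g x)| + eps))^-1 <=
    Q ^+ 2 / (2 * rho) * ((ab x).2 - (ab x).1).
  move=> xx; have [_ h _ _] := hab x xx.
  set Pi := \prod_(k < p) _ => hP.
  have Pi0 : 0 < Pi by apply: prodr_gt0 => k _; rewrite ltr_wpDl.
  rewrite -(ler_pM2l Pi0) divff ?gt_eqF //.
  have -> : Pi * (Q ^+ 2 / (2 * rho) * ((ab x).2 - (ab x).1)) =
    Pi * (Q ^+ 2 * ((ab x).2 - (ab x).1)) / (2 * rho) by ring.
  by rewrite ler_pdivlMr ?mul1r //; lra.
apply: (@le_trans _ _ (\sum_(x <- xs) Q ^+ 2 / (2 * rho) * ((ab x).2 - (ab x).1))).
  by rewrite big_seq [leRHS]big_seq; apply: ler_sum.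
rewrite -mulr_sumr.
apply: (@le_trans _ _ (Q ^+ 2 / (2 * rho) * (2 * rho - - (2 * rho)))).
  by apply: ler_wpM2l => //; apply: divr_ge0; [exact: sqr_ge0|lra].
by rewrite le_eqVlt; apply/orP; left; apply/eqP; field; lra.
Qed.

Lemma fine_partition {R : realType} (M kap : R) : 0 < kap ->
  exists (m : nat) (q : R -> 'I_m.+1), forall r r',
    `|r| <= M -> `|r'| <= M -> q r = q r' -> `|r - r'| <= kap.
Proof.
move=> k0; pose h r := Num.truncn ((r + M) / kap).
exists (Num.truncn (2 * M / kap)), (fun r => inord (h r)) => r r' hr hr'.
have hb (s : R) : `|s| <= M -> 0 <= (s + M) / kap /\
    (h s < (Num.truncn (2 * M / kap)).+1)%N.
  rewrite ler_norml => /andP[s1 s2]; split; first by apply: divr_ge0; lra.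
  by rewrite ltnS; apply: le_truncn; rewrite ler_pM2r ?invr_gt0 //; lra.
have [r0 hr1] := hb r hr; have [r0' hr1'] := hb r' hr'.
move=> /(congr1 val) /=; rewrite !inordK // => hE.
have := truncn_itv r0; have := truncn_itv r0'.
rewrite -/(h r) -/(h r') hE => /andP[a1 a2] /andP[b1 b2].
move: a1 a2 b1 b2; rewrite !ler_pdivlMr // !ltr_pdivrMr // -natr1.
by rewrite mulrDl mul1r ler_norml => *; apply/andP; split; lra.
Qed.

(** The points [x] are sorted into finitely many cells according to the positions
    of [x] and of [e x].  This replaces the continuity of the unstable direction:
    within a cell, any point provides a segment that suits all the others. *)
Lemma period_sum {R : realType} (g : 'rV[R]_2 -> 'rV[R]_2)
    (X : set 'rV[R]_2) (l Q c eps M : R) (e f : 'rV[R]_2 -> 'rV[R]_2)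
    (A B : 'rV[R]_2 -> R) :
  adapted_frame g X l Q e f A B -> 1 <= Q -> 0 <= c ->
  (forall x, differentiable g x) -> quad_approx c g ->
  (forall x, X x -> X (g x)) -> (forall x, X x -> `|x| <= M) ->
  0 < l < 1 -> 0 < eps -> 1 + eps < l^-1 -> l + eps < 1 ->
  exists2 S : R, 0 <= S & forall (p : nat) (xs : seq 'rV[R]_2),
    (0 < p)%N -> uniq xs ->
    (forall x, x \in xs -> X x /\ iter p g x = x) ->
    \sum_(x <- xs) (\prod_(k < p) (`|A (iter k g x)| + eps))^-1 <= S.
Proof.
move=> fr Q1 c0 dg qg gX XM l01 eps0 le1 le2.
have Xorb x : X x -> forall k, X (iter k g x).
  by move=> Xx; elim=> [|k IH] //=; exact: gX.
have Q0 : 0 < Q by lra.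
pose rho := eps / (2 * Q ^+ 3 * (c + 1)).
have d0 : 0 < 2 * Q ^+ 3 * (c + 1).
  by rewrite !mulr_gt0 // ?exprn_gt0 //; lra.
have rho0 : 0 < rho by rewrite divr_gt0.
have hQ : Q * (c * (2 * (Q * rho))) * Q <= eps.
  have -> : Q * (c * (2 * (Q * rho))) * Q = (2 * Q ^+ 3 * c) * rho by ring.
  rewrite /rho mulrCA -[leRHS]mulr1; apply: ler_wpM2l; first exact: ltW.
  rewrite ler_pdivrMr // mul1r; apply: ler_wpM2l; last lra.
  by rewrite mulr_ge0 // exprn_ge0 // ltW.
pose kap := rho / (Q * (1 + 2 * rho)).
have d1 : 0 < Q * (1 + 2 * rho) by rewrite mulr_gt0 //; lra.
have kap0 : 0 < kap by rewrite divr_gt0.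
have hkap : Q * (kap + 2 * rho * kap) <= rho.
  rewrite /kap le_eqVlt; apply/orP; left; apply/eqP; field; apply/andP; split; lra.
have [m [q hq]] := @fine_partition R (M + Q) kap kap0.
pose cell (x : 'rV[R]_2) := ((q (x 0 0), q (x 0 1)), (q (e x 0 0), q (e x 0 1))).
exists (\sum_(j : ('I_m.+1 * 'I_m.+1) * ('I_m.+1 * 'I_m.+1)) 2 * Q ^+ 2).
  by apply: sumr_ge0 => j _; rewrite mulr_ge0 // sqr_ge0.
move=> p xs p0 uxs hxs.
rewrite (partition_big cell predT) //=; apply: ler_sum => j _.
rewrite -big_filter; case E : [seq i <- xs | cell i == j] => [|y ys].
  by rewrite big_nil mulr_ge0 // sqr_ge0.
have hy : y \in [seq i <- xs | cell i == j] by rewrite E inE eqxx.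
move: hy; rewrite mem_filter => /andP[/eqP cy yxs]; have [Xy _] := hxs y yxs.
rewrite -E.
have close (v w : 'rV[R]_2) : `|v| <= M + Q -> `|w| <= M + Q ->
    q (v 0 0) = q (w 0 0) -> q (v 0 1) = q (w 0 1) -> `|v - w| <= kap.
  rewrite !row2_norm !ge_max => /andP[v0 v1] /andP[w0 w1] q0 q1.
  by rewrite !mxE !hq.
apply: (@period_cell_sum R g X l Q c eps rho kap e f A B y (e y) p) => //.
- exact: (frame_vec fr Xy).
- exact: filter_uniq.
move=> x; rewrite mem_filter => /andP[/eqP cx xxs]; have [Xx px] := hxs x xxs.
move: cx; rewrite -cy => -[c1 c2 c3 c4].
have hX z : X z -> `|z| <= M + Q by move/XM => h; lra.
have M0 : 0 <= M by apply: le_trans (XM _ Xx).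
have he z : X z -> `|e z| <= M + Q by move/(frame_vec fr) => h; lra.
by split => //; [exact: Xorb|apply: close => //; exact: hX|
  apply: close => //; exact: he].
Qed.

Lemma powRN_le {R : realType} (x y t : R) :
  0 < x -> x <= y -> 0 <= t -> y `^ (- t) <= x `^ (- t).
Proof.
move=> x0 xy t0; have y0 := lt_le_trans x0 xy.
rewrite !powRN lef_pV2 ?posrE ?powR_gt0 //.
by apply: ge0_ler_powR; rewrite ?nnegrE // ltW.
Qed.

(** With [lam = 1 / l], [mu] strictly between [1] and [lam] and [q = mu ^ (1 - t) < 1],
    each point of period [p] contributes at most [th ^ p] times the summand of
    [period_sum], where [th = q (lam + eps) / (lam - eps)] is less than one for a
    small [eps]. *)
Lemma multiplier_sum {R : realType} (g : 'rV[R]_2 -> 'rV[R]_2)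
    (X : set 'rV[R]_2) (l Q c M t : R) (e f : 'rV[R]_2 -> 'rV[R]_2)
    (A B : 'rV[R]_2 -> R) :
  adapted_frame g X l Q e f A B -> 1 <= Q -> 0 <= c ->
  (forall x, differentiable g x) -> quad_approx c g ->
  (forall x, X x -> X (g x)) -> (forall x, X x -> `|x| <= M) ->
  0 < l < 1 -> 1 < t ->
  exists eps S, [/\ 0 < eps, 1 + eps < l^-1, l + eps < 1, 0 <= S &
    forall (xs : seq 'rV[R]_2) (p : 'rV[R]_2 -> nat) (s : 'rV[R]_2 -> R),
    uniq xs ->
    (forall x, x \in xs -> [/\ X x, (0 < p x)%N, iter (p x) g x = x &
       \prod_(k < p x) (`|A (iter k g x)| - eps) <= s x]) ->
    \sum_(x <- xs) (s x) `^ (- t) <= S].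
Proof.
move=> fr Q1 c0 dg qg gX XM l01 t1.
have /andP[l0 l1] := l01.
have Xorb x : X x -> forall k, X (iter k g x).
  by move=> Xx; elim=> [|k IH] //=; exact: gX.
set lam := l^-1; have lam1 : 1 < lam by rewrite /lam invf_gt1.
pose mu := (1 + lam) / 2; have mu1 : 1 < mu by rewrite /mu; lra.
pose q := mu `^ (1 - t).
have q0 : 0 <= q by exact: powR_ge0.
have q1 : q < 1.
  rewrite lt_neqAle; apply/andP; split.
    by rewrite /q powR_eq1; apply/negP => /or3P[/eqP||/eqP]; lra.
  by have := @ler_powR _ mu (ltW mu1) (1 - t) 0; rewrite powRr0; apply; lra.
pose eps := Num.min ((1 - l) / 2) (Num.min ((lam - 1) / 4) (lam * (1 - q) / 4)).
have eps0 : 0 < eps.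
  by rewrite !lt_min; apply/andP; split; [lra|apply/andP; split; [lra|nra]].
have [eps1 eps2 eps3] :
    [/\ eps <= (1 - l) / 2, eps <= (lam - 1) / 4 & eps <= lam * (1 - q) / 4].
  by split; rewrite /eps ?ge_min lexx // ?orbT // !ge_min lexx ?orbT.
have [||S S0 HS] := @period_sum R g X l Q c eps M e f A B fr Q1 c0 dg qg gX XM l01 eps0.
- by rewrite -/lam; lra.
- by lra.
pose th := (lam + eps) / (lam - eps) * q.
have th0 : 0 <= th by apply: mulr_ge0 => //; apply: divr_ge0; lra.
have th1 : th < 1.
  rewrite /th mulrAC ltr_pdivrMr; last lra.
  nra.
exists eps, (S / (1 - th)); split => //; try (rewrite -/lam; lra).
  by apply: divr_ge0; lra.
move=> xs p s uxs hxs.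
have each x : x \in xs -> s x `^ (- t) <=
    th ^+ p x * (\prod_(k < p x) (`|A (iter k g x)| + eps))^-1.
  move=> xx; have [Xx px0 px hs] := hxs x xx.
  set P := \prod_(k < p x) (`|A (iter k g x)| - eps) in hs.
  set P' := \prod_(k < p x) (`|A (iter k g x)| + eps).
  have muP : mu ^+ p x <= P.
    apply: le_trans (frame_prod_gt1 (p x) fr (Xorb _ Xx) _); rewrite -/lam; last lra.
    by apply: lerXn2r; rewrite ?nnegrE /mu; clear -lam1 eps2; lra.
  have mup : 0 < mu ^+ p x by rewrite exprn_gt0 //; lra.
  have P0 : 0 < P by lra.
  have P'0 : 0 < P' by apply: prodr_gt0 => k _; rewrite ltr_wpDl.
  have hP' : P' <= ((lam + eps) / (lam - eps)) ^+ p x * P.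
    have -> : ((lam + eps) / (lam - eps)) ^+ p x =
       \prod_(k < p x) ((lam + eps) / (lam - eps)) by rewrite prodr_const card_ord.
    rewrite /P -big_split /=; apply: ler_prod => k _.
    have [hA _] := frame_rate fr (Xorb _ Xx k); rewrite -/lam in hA.
    rewrite addr_ge0 //=; last exact: ltW.
    by rewrite mulrAC ler_pdivlMr; [nra|lra].
  apply: (@le_trans _ _ (P `^ (- t))).
    by apply: (powRN_le P0 hs); clear -t1; lra.
  have -> : P `^ (- t) = P^-1 * P `^ (1 - t).
    rewrite -powR_inv1; last exact: ltW.
    by rewrite -powRD ?(gt_eqF P0) ?implybT //; congr (_ `^ _); ring.
  have -> : th ^+ p x = ((lam + eps) / (lam - eps)) ^+ p x * q ^+ p x.
    by rewrite -exprMn.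
  rewrite mulrAC; apply: ler_pM.
  - by rewrite invr_ge0 ltW.
  - exact: powR_ge0.
  - by rewrite -[P^-1]mul1r ler_pdivrMr // mulrAC ler_pdivlMr // mul1r.
  have -> : q ^+ p x = (mu ^+ p x) `^ (1 - t).
    by rewrite -powR_mulrn ?powR_ge0 // -powRrM mulrC powRrM powR_mulrn //; clear -mu1; lra.
  have -> : 1 - t = - (t - 1) by ring.
  by apply: (powRN_le mup muP); clear -t1; lra.
apply: (@le_trans _ _ (\sum_(x <- xs)
   th ^+ p x * (\prod_(k < p x) (`|A (iter k g x)| + eps))^-1)).
  by rewrite big_seq [leRHS]big_seq; apply: ler_sum.
pose N := \max_(x <- xs) p x.
have hN x : x \in xs -> (p x < N.+1)%N.
  by move=> xx; rewrite ltnS /N; apply: leq_bigmax_seq.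
rewrite big_seq (partition_big (fun x => inord (p x) : 'I_N.+1) predT) //=.
apply: (@le_trans _ _ (\sum_(j < N.+1) th ^+ j * S)).
  apply: ler_sum => j _.
  apply: (@le_trans _ _ (\sum_(x <- [seq x <- xs | p x == j :> nat])
     th ^+ j * (\prod_(k < j) (`|A (iter k g x)| + eps))^-1)).
    rewrite big_filter le_eqVlt; apply/orP; left; apply/eqP.
    rewrite [RHS]big_seq_cond; apply: eq_big => [x|x /andP[xx /eqP <-]].
      have [xx|//] := boolP (x \in xs); rewrite /=.
      by rewrite -val_eqE /= inordK // hN.
    by rewrite inordK // hN.
  rewrite -mulr_sumr; apply: ler_wpM2l; first exact: exprn_ge0.
  have [j0|j0] := posnP j.
    rewrite (_ : [seq x <- xs | p x == j :> nat] = [::]) ?big_nil //.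
    apply/eqP; rewrite -size_eq0 size_filter -leqn0 leqNgt -has_count.
    apply/hasP => -[x xx]; have [_ px0 _ _] := hxs x xx.
    by rewrite j0 => /eqP h; rewrite h in px0.
  apply: HS => //; first exact: filter_uniq.
  move=> x; rewrite mem_filter => /andP[/eqP <- xx].
  by have [Xx _ px _] := hxs x xx.
rewrite -mulr_suml mulrC; apply: ler_wpM2l => //.
have h : (1 - th) * \sum_(j < N.+1) th ^+ j = 1 - th ^+ N.+1.
  by have E := subrX1 th N.+1; clear -E; lra.
have : 0 <= th ^+ N.+1 by exact: exprn_ge0.
rewrite -[(1 - th)^-1]mul1r ler_pdivlMr; last lra.
by rewrite mulrC h; lra.
Qed.

(** * Multipliers of nearby maps *)

(** [w] is an orbit of tangent vectors of a map close to [g], over the continuation of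
    the cycle of [x], that starts at an eigenvector of the derivative of the period
    map, with eigenvalue [s]. *)
Definition pseudo_tangent {R : realType} (g : 'rV[R]_2 -> 'rV[R]_2)
    (x : 'rV[R]_2) (p : nat) (eta s : R) (w : nat -> 'rV[R]_2) : Prop :=
  [/\ forall k, `|w k.+1 - 'd g (iter k g x) (w k)| <= eta * `|w k|,
      forall k, w (k + p)%N = s *: w k & w 0%N != 0].

Lemma pseudo_tangent_block {R : realType} (g : 'rV[R]_2 -> 'rV[R]_2)
    (X : set 'rV[R]_2) (L eta : R) (x : 'rV[R]_2) (w : nat -> 'rV[R]_2) (j m : nat) :
  (forall x, differentiable g x) -> (forall k, X (iter k g x)) ->
  1 <= L -> 0 <= eta -> (forall x v, X x -> `|'d g x v| <= L * `|v|) ->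
  (forall k, `|w k.+1 - 'd g (iter k g x) (w k)| <= eta * `|w k|) ->
  `|w (m + j)%N - 'd (iter m g) (iter j g x) (w j)| <=
    eta * m%:R * (L + eta) ^+ m * `|w j|.
Proof.
move=> dg Xx L1 eta0 hL hw.
have Xj k : X (iter k g (iter j g x)) by rewrite -iterD.
suff : `|w (m + j)%N| <= (L + eta) ^+ m * `|w j| /\
    `|w (m + j)%N - 'd (iter m g) (iter j g x) (w j)| <=
    eta * m%:R * (L + eta) ^+ m * `|w j| by case.
elim: m => [|m [IH1 IH2]].
  by rewrite add0n diff_iter0 subrr normr0 expr0 mul1r mulr0 !mul0r.
rewrite addSn; set W := w (m + j)%N in IH1 IH2 *.
have h := hw (m + j)%N; rewrite -/W iterD in h.
have hd := hL _ W (Xj m).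
have W0 := normr_ge0 W; have wj0 := normr_ge0 (w j).
split.
  have := ler_normD (w (m + j).+1 - 'd g (iter m g (iter j g x)) W)
    ('d g (iter m g (iter j g x)) W); rewrite subrK => h'.
  apply: (le_trans h'); rewrite exprS -mulrA.
  apply: (@le_trans _ _ ((L + eta) * `|W|)); first by lra.
  by apply: ler_wpM2l => //; lra.
set D := 'd (iter m g) (iter j g x) (w j) in IH2.
have E : 'd (iter m.+1 g) (iter j g x) (w j) = 'd g (iter m g (iter j g x)) D.
  exact: diff_iterS.
have E2 : w (m + j).+1 - 'd (iter m.+1 g) (iter j g x) (w j) =
    (w (m + j).+1 - 'd g (iter m g (iter j g x)) W) +
    'd g (iter m g (iter j g x)) (W - D).
  have E3 := linearB ('d g (iter m g (iter j g x))) W D.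
  apply: (eq_trans (congr1 (fun z => w (m + j).+1 - z) E)).
  apply: (eq_trans _ (congr1 (fun z => _ + z) (esym E3))).
  by rewrite addrA subrK.
apply: (le_trans (eq_ind_r (fun z => `|z| <= _) (ler_normD _ _) E2)).
have hd2 := hL _ (W - D) (Xj m).
have p0 : 0 <= (L + eta) ^+ m by apply: exprn_ge0; lra.
have h1 : eta * `|W| <= eta * ((L + eta) ^+ m * `|w j|) by apply: ler_wpM2l.
have h2 : L * `|W - D| <= L * (eta * m%:R * (L + eta) ^+ m * `|w j|).
  by apply: ler_wpM2l => //; lra.
rewrite exprS -natr1.
set z := (L + eta) ^+ m * `|w j|.
have z0 : 0 <= z by exact: mulr_ge0.
have k1 : eta * z <= (L + eta) * (eta * z).
  by rewrite ler_peMl //; [exact: mulr_ge0|lra].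
have mz : 0 <= eta * m%:R * z by apply: mulr_ge0 => //; apply: mulr_ge0.
have k2 : L * (eta * m%:R * z) <= (L + eta) * (eta * m%:R * z).
  by apply: ler_wpM2r => //; lra.
have -> : eta * (m%:R + 1) * ((L + eta) * (L + eta) ^+ m) * `|w j| =
  (L + eta) * (eta * m%:R * z) + (L + eta) * (eta * z) by rewrite /z; ring.
have e2 : eta * m%:R * (L + eta) ^+ m * `|w j| = eta * m%:R * z by rewrite /z; ring.
rewrite e2 in h2.
by rewrite -/z in h1; lra.
Qed.

Lemma pseudo_tangentM {R : realType} (g : 'rV[R]_2 -> 'rV[R]_2)
    (x : 'rV[R]_2) (p : nat) (eta s : R) (w : nat -> 'rV[R]_2) (j : nat) :
  pseudo_tangent g x p eta s w -> w (j * p)%N = s ^+ j *: w 0%N.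
Proof.
move=> [_ hp _]; elim: j => [|j IH]; first by rewrite mul0n expr0 scale1r.
by rewrite mulSn addnC hp IH scalerA exprS.
Qed.

(** Stated for both orders of the two bundles.  A fiber of [E] that vanishes at one
    point of a cycle vanishes on the whole cycle, because the derivative maps fibers
    onto fibers. *)
Lemma not_split_periodic {R : realType} (g : 'rV[R]_2 -> 'rV[R]_2)
    (X : set 'rV[R]_2) (E F : 'rV[R]_2 -> {vspace 'rV[R]_2}) (x : 'rV[R]_2) p k :
  (forall k, X (iter k g x)) -> (0 < p)%N -> iter p g x = x ->
  (forall z, X z -> (E z + F z)%VS = fullv /\
    [set 'd g z v | v in [set v | v \in E z]] = [set v | v \in E (g z)]) ->
  ~ (exists2 s, s \in E (iter k g x) & s != 0) ->
  forall j v, v \in F (iter j g x).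
Proof.
move=> Xx p0 px hyp nE.
have per i j : iter (i * p + j) g x = iter j g x.
  elim: i => [|i IH] //; rewrite mulSn -addnA addnC iterD px.
  exact: IH.
have E0 : forall j v, v \in E (iter (j + k) g x) -> v = 0.
  elim=> [v vE|j IH v].
    by apply/eqP/negPn/negP => v0; apply: nE; exists v.
  rewrite addSn iterS.
  have [_ h] := hyp _ (Xx (j + k)%N) => vE.
  have : [set v | v \in E (g (iter (j + k) g x))] v by [].
  by rewrite -h => -[u /= /IH -> <-]; rewrite linear0.
move=> j v.
have [h _] := hyp _ (Xx (k * p + j)%N).
have : v \in (E (iter (k * p + j) g x) + F (iter (k * p + j) g x))%VS.
  by rewrite h memvf.
move=> /memv_addP [a aE [b bF ->]].
have -> : a = 0.
  (* [k * p + j] is a time, at least [k], when the orbit is at [iter j g x]. *)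
  apply: (E0 (k * p + j - k)%N); rewrite subnK //.
  by apply: leq_trans (leq_addr _ _); rewrite leq_pmulr.
by rewrite add0r -(per k).
Qed.

(** To apply [multiplier_sum], the two bundles must be lines at the points
    considered.  Otherwise one of them is the whole plane along the cycle, and then
    some iterate [g ^ m] contracts, or expands, all vectors; so does the
    corresponding composition for a nearby map, which excludes one of the
    multipliers [s] and [r]. *)
Lemma hyperbolic_multiplier_sum {R : realType} (g : 'rV[R]_2 -> 'rV[R]_2)
    (X : set 'rV[R]_2) (c L M t : R) :
  (forall x, differentiable g x) -> 0 <= c -> quad_approx c g ->
  (forall x, X x -> X (g x)) -> (forall x, X x -> `|x| <= M) ->
  1 <= L -> (forall x v, X x -> `|'d g x v| <= L * `|v|) ->
  hyperbolic_on g X -> 1 < t ->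
  exists eta S, [/\ 0 < eta, 0 <= S &
    forall (xs : seq 'rV[R]_2) (p : 'rV[R]_2 -> nat) (s : 'rV[R]_2 -> R),
    uniq xs ->
    (forall x, x \in xs -> [/\ X x, (0 < p x)%N, iter (p x) g x = x, 1 < `|s x| &
       (exists w, pseudo_tangent g x (p x) eta (s x) w) /\
       exists2 r : R, `|r| < 1 & exists w, pseudo_tangent g x (p x) eta r w]) ->
    \sum_(x <- xs) `|s x| `^ (- t) <= S].
Proof.
move=> dg c0 qg gX XM L1 hL [Es [Eu [C [l [C0 l01 hyp]]]]] t1.
have /andP[l0 l1] := l01.
have L0 : 0 <= L by lra.
have [Q [e [f [A [B [Q1 fr]]]]]] := adapted_frame_exists dg gX L0 hL C0 l01 hyp.
set X1 := X `&` split_at g Es Eu in fr.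
have gX1 x : X1 x -> X1 (g x).
  by move=> [Xx Sx]; split; [exact: gX|move=> k; rewrite -iterSr; exact: Sx].
have X1M x : X1 x -> `|x| <= M by move=> [/XM].
have [eps [S [eps0 le1 le2 S0 HS]]] :=
  multiplier_sum fr Q1 c0 dg qg gX1 X1M l01 t1.
have [||m hm] := @small_power R C l (2^-1); rewrite ?invr_gt0 ?(ltW l0) ?l1 //.
have {}hm : C * l ^+ m.+1 <= 2^-1.
  apply: le_trans hm; rewrite exprS mulrCA -[leRHS]mul1r; apply: ler_wpM2r; last lra.
  by rewrite mulr_ge0 ?exprn_ge0 // ltW.
have d1 : 0 < 2 * m.+1%:R * (L + 1) ^+ m.+1.
  by rewrite !mulr_gt0 // exprn_gt0 //; lra.
have Q20 : 0 < Q ^+ 2 by rewrite exprn_gt0 //; lra.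
pose eta := Num.min (Num.min 1 (2 * m.+1%:R * (L + 1) ^+ m.+1)^-1) (eps / Q ^+ 2).
have eta0 : 0 < eta by rewrite !lt_min ltr01 invr_gt0 d1 divr_gt0.
have eta1 : eta <= 1 by rewrite /eta !ge_min lexx.
have eta2 : eta * m.+1%:R * (L + eta) ^+ m.+1 <= 2^-1.
  have h : eta <= (2 * m.+1%:R * (L + 1) ^+ m.+1)^-1.
    by rewrite /eta !ge_min lexx orbT.
  have : eta * (2 * m.+1%:R * (L + 1) ^+ m.+1) <= 1.
    by rewrite -ler_pdivlMr // mul1r.
  have : eta * m.+1%:R * (L + eta) ^+ m.+1 <= eta * m.+1%:R * (L + 1) ^+ m.+1.
    apply: ler_wpM2l; first by rewrite mulr_ge0 // ltW.
    by apply: lerXn2r; rewrite ?nnegrE; clear -eta0 eta1 L1; lra.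
  lra.
have eta3 : Q * eta * Q <= eps.
  have : eta <= eps / Q ^+ 2 by rewrite /eta ge_min lexx orbT.
  by rewrite ler_pdivlMr // expr2 mulrCA mulrA.
have block x w j : (forall k, X (iter k g x)) ->
    (forall k, `|w k.+1 - 'd g (iter k g x) (w k)| <= eta * `|w k|) ->
    `|w (m.+1 + j)%N - 'd (iter m.+1 g) (iter j g x) (w j)| <= 2^-1 * `|w j|.
  move=> Xx hw.
  apply: (le_trans (@pseudo_tangent_block R g X L eta x w j m.+1 dg Xx L1 (ltW eta0) hL hw)).
  exact: ler_wpM2r.
exists eta, S; split => // xs p s uxs hxs.
apply: (HS xs p (fun x => `|s x|)) => // x xx.
have [Xx0 p0 px s1 [[w hw] [r r1 [w' hw']]]] := hxs x xx.
have Xx k : X (iter k g x) by elim: k => [|k IH] //=; exact: gX.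
suff X1x : X1 x.
  split => //.
  have X1k k : X1 (iter k g x) by elim: k => [|k IH] //=; exact: gX1.
  have [w1 w2 w3] := hw.
  apply: (@frame_multiplier R g X1 l Q eta eps (s x) e f A B x (p x) w) => //;
    rewrite ?(ltW eta0) ?(ltW le1) ?(ltW s1) //.
    by lra.
  by rewrite -w2.
split => // k; split; apply: contrapT => nE.
  (* Without unstable vectors the stable spaces fill the plane, and the
     eigenvector for [s x] would be contracted. *)
  have full := not_split_periodic (F := Es) (E := Eu) Xx p0 px _ nE.
  have {}full : forall j v, v \in Es (iter j g x).
    apply: full => z Xz; have [[h1 _] _ h2 _ _] := hyp z Xz.
    by rewrite addvC.
  have [w1 w2 w3] := hw.
  have step j : `|w (m.+1 + j)%N| <= `|w j|.
    have := block x w j Xx w1.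
    have [_ _ _ /(_ m.+1 _ (full j (w j))) h _] := hyp _ (Xx j).
    set D := 'd (iter m.+1 g) _ _ in h *.
    have : C * l ^+ m.+1 * `|w j| <= 2^-1 * `|w j| by apply: ler_wpM2r.
    have := ler_normD (w (m.+1 + j)%N - D) D; rewrite subrK.
    by move: h (normr_ge0 (w j)); clear; lra.
  have iterj : forall i, `|w (i * m.+1)%N| <= `|w 0%N|.
    elim=> [|i IH]; first by rewrite mul0n.
    by rewrite mulSn; apply: (le_trans (step _)).
  have := iterj (p x); rewrite mulnC (pseudo_tangentM _ hw) normrZ normrX.
  have w00 : 0 < `|w 0%N| by rewrite normr_gt0.
  rewrite ger_pMl // => h.
  have : 1 < `|s x| ^+ m.+1 by rewrite exprn_egt1.
  by move: h; clear; lra.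
(* Without stable vectors the unstable spaces fill the plane, and the
   eigenvector for [r] would be expanded. *)
have full := not_split_periodic (F := Eu) (E := Es) Xx p0 px _ nE.
have {}full : forall j v, v \in Eu (iter j g x).
  by apply: full => z Xz; have [[h1 _] h2 _ _ _] := hyp z Xz.
have [w1 w2 w3] := hw'.
have step j : `|w' j| <= `|w' (m.+1 + j)%N|.
  have := block x w' j Xx w1.
  have [_ _ _ _ /(_ m.+1 _ (full j (w' j))) h] := hyp _ (Xx j).
  set D := 'd (iter m.+1 g) _ _ in h *.
  have : C * l ^+ m.+1 * `|D| <= 2^-1 * `|D| by apply: ler_wpM2r.
  have := ler_normB (w' (m.+1 + j)%N) (w' (m.+1 + j)%N - D).
  rewrite opprB addrC subrK.
  by move: h (normr_ge0 (w' j)); clear; lra.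
have iterj : forall i, `|w' 0%N| <= `|w' (i * m.+1)%N|.
  elim=> [|i IH]; first by rewrite mul0n.
  by rewrite mulSn; apply: (le_trans _ (step _)).
have := iterj (p x); rewrite mulnC (pseudo_tangentM _ hw') normrZ normrX.
have w00 : 0 < `|w' 0%N| by rewrite normr_gt0.
rewrite ler_pMl // => h.
have : `|r| ^+ m.+1 < 1 by rewrite exprn_ilt1.
by move: h; clear; lra.
Qed.

(** * Derivatives of the maps of a family *)

Definition pt3 {R : realType} (a x y : R) : 'rV[R]_3 :=
  \row_(i < 3) nth 0 [:: a; x; y] i.

Lemma pt3E {R : realType} (a x y : R) :
  [/\ pt3 a x y 0 0 = a, pt3 a x y 0 1 = x & pt3 a x y 0 2%:R = y].
Proof. by split; rewrite mxE. Qed.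

Lemma ptE {R : realType} (x y : R) : pt x y 0 0 = x /\ pt x y 0 1 = y.
Proof. by split; rewrite mxE. Qed.

Lemma pt_eta {R : realType} (z : 'rV[R]_2) : z = pt (z 0 0) (z 0 1).
Proof. by have [h0 h1] := ptE (z 0 0) (z 0 1); apply: row2P; rewrite ?h0 ?h1. Qed.

Lemma pt3_step {R : realType} (a x y t : R) :
  [/\ t *: delta_mx 0 0 + pt3 a x y = pt3 (t + a) x y,
      t *: delta_mx 0 1 + pt3 a x y = pt3 a (t + x) y &
      t *: delta_mx 0 2%:R + pt3 a x y = pt3 a x (t + y)].
Proof.
by split; apply/rowP => -[[|[|[|//]]] hi]; rewrite !mxE /= ?mulr1 ?mulr0 ?add0r.
Qed.

Lemma directional_mean_value {R : realType} (G : 'rV[R]_3 -> R^o)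
    (e u : 'rV[R]_3) (T : R) :
  (forall s, 0 <= s <= T -> derivable G (s *: e + u) e) -> 0 <= T ->
  exists2 s, 0 <= s <= T & G (T *: e + u) - G u = 'D_e G (s *: e + u) * T.
Proof.
move=> dG T0; pose phi (s : R) := G (s *: e + u) : R.
have quot s : (fun h => h^-1 *: ((phi \o shift s) (h *: (1 : R)) - phi s)) =
    (fun h => h^-1 *: ((G \o shift (s *: e + u)) (h *: e) - G (s *: e + u)) : R).
  apply/funext => h /=; rewrite /phi; congr (_ *: (G _ - _)).
  by rewrite [h *: 1]mulr1 scalerDl addrA.
have dphi s : 0 <= s <= T -> is_derive s 1 phi ('D_e G (s *: e + u)).
  move=> hs; split.
    by rewrite /derivable quot; exact: dG.
  by rewrite /derive quot.
have [||s] := @MVT_segment R phi (fun s => 'D_e G (s *: e + u)) 0 T T0.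
- by move=> s; rewrite in_itv /= => /andP[s0 s1]; apply: dphi; rewrite !ltW.
- apply: derivable_within_continuous => s; rewrite in_itv /= => hs.
  by have [] := dphi s hs.
rewrite in_itv /= => hs E; exists s => //.
by move: E; rewrite /phi scale0r add0r subr0.
Qed.

Lemma line_mean_value {R : realType} (G : 'rV[R]_3 -> R^o) (e : 'rV[R]_3)
    (c : R -> 'rV[R]_3) (x x' : R) :
  (forall s t, c t = (t - s) *: e + c s) ->
  (forall s, Num.min x x' <= s <= Num.max x x' -> derivable G (c s) e) ->
  exists2 s, Num.min x x' <= s <= Num.max x x' &
    G (c x) - G (c x') = 'D_e G (c s) * (x - x').
Proof.
move=> hc; wlog le : x x' / x' <= x => [hw|].
  case/orP: (le_total x' x) => h; first exact: hw.
  rewrite minC maxC => hd; have [s hs E] := hw x' x h hd.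
  by exists s => //; rewrite -opprB E -mulrN opprB.
rewrite (min_r le) (max_l le) => hd.
have [||s hs E] := @directional_mean_value R G e (c x') (x - x').
- by move=> s /andP[s0 s1]; have := hd (s + x'); rewrite (hc x' (s + x')) addrK; apply; lra.
- by lra.
exists (s + x'); first by lra.
by rewrite (hc x' x) E (hc x' (s + x')) addrK.
Qed.

Definition unit_partials {R : realType} (G : 'rV[R]_3 -> R^o) : Prop :=
  forall i a x y, -3%:R < a < 1 ->
    derivable G (pt3 a x y) (delta_mx 0 i) /\
    `|'D_(delta_mx 0 i) G (pt3 a x y)| <= 1.

Lemma pt3_line {R : realType} (a x y : R) :
  [/\ forall s t, pt3 t x y = (t - s) *: delta_mx 0 0 + pt3 s x y,
      forall s t, pt3 a t y = (t - s) *: delta_mx 0 1 + pt3 a s y &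
      forall s t, pt3 a x t = (t - s) *: delta_mx 0 2%:R + pt3 a x s].
Proof.
by split=> s t; [have [-> _ _] := pt3_step s x y (t - s)|
  have [_ -> _] := pt3_step a s y (t - s)|
  have [_ _ ->] := pt3_step a x s (t - s)]; rewrite subrK.
Qed.

Lemma unit_partials_lipschitz {R : realType} (G : 'rV[R]_3 -> R^o)
    (a a' x x' y y' : R) :
  unit_partials G -> -3%:R < a < 1 -> -3%:R < a' < 1 ->
  `|(G (pt3 a x y) : R) - G (pt3 a' x' y')| <= `|a - a'| + `|x - x'| + `|y - y'|.
Proof.
move=> uG ha ha'.
have bound i (c : R -> 'rV[R]_3) s s' :
    (forall s t, c t = (t - s) *: delta_mx 0 i + c s) ->
    (forall r, Num.min s s' <= r <= Num.max s s' ->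
      exists b u v, -3%:R < b < 1 /\ c r = pt3 b u v) ->
    `|(G (c s) : R) - G (c s')| <= `|s - s'|.
  move=> hc hr.
  have [|r hr' ->] := @line_mean_value R G (delta_mx 0 i) c s s' hc.
    by move=> r /hr [b [u [v [hb ->]]]]; have [] := uG i b u v hb.
  have [b [u [v [hb ->]]]] := hr r hr'; have [_ h] := uG i b u v hb.
  by rewrite normrM ler_piMl.
have [l0 _ _] := pt3_line 0 x y.
have [_ l1 _] := pt3_line a' 0 y.
have [_ _ l2] := pt3_line a' x' 0.
have h0 : `|(G (pt3 a x y) : R) - G (pt3 a' x y)| <= `|a - a'|.
  apply: (bound 0 (fun t => pt3 t x y)) => // r hr; exists r, x, y; split => //.
  by move: hr; rewrite ge_min le_max => /andP[/orP[] h1 /orP[] h2]; lra.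
have h1 : `|(G (pt3 a' x y) : R) - G (pt3 a' x' y)| <= `|x - x'|.
  by apply: (bound 1 (fun t => pt3 a' t y)) => // r hr; exists a', r, y.
have h2 : `|(G (pt3 a' x' y) : R) - G (pt3 a' x' y')| <= `|y - y'|.
  by apply: (bound 2%:R (fun t => pt3 a' x' t)) => // r hr; exists a', x', r.
have -> : (G (pt3 a x y) : R) - G (pt3 a' x' y') =
    ((G (pt3 a x y) : R) - G (pt3 a' x y)) +
    ((G (pt3 a' x y) : R) - G (pt3 a' x' y)) +
    ((G (pt3 a' x' y) : R) - G (pt3 a' x' y')) by ring.
apply: (le_trans (ler_normD _ _)); apply: lerD => //.
by apply: (le_trans (ler_normD _ _)); apply: lerD.
Qed.

Lemma between_dist {R : realType} (x x' r z m : R) :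
  Num.min x x' <= r <= Num.max x x' -> `|x - z| <= m -> `|x' - z| <= m ->
  `|r - z| <= m.
Proof.
rewrite ge_min le_max => /andP[/orP[] h1 /orP[] h2]; rewrite !ler_norml
  => /andP[h3 h4] /andP[h5 h6]; apply/andP; split; lra.
Qed.

(** The mean value theorem is used along one coordinate and then the other; at
    the intermediate points, the partial derivatives differ from those at
    [(x0, y0)] by at most [2 * m]. *)
Lemma quadratic_remainder {R : realType} (F : 'rV[R]_3 -> R^o)
    (a x x' x0 y y' y0 m d : R) :
  (forall i a x y, -3%:R < a < 1 -> derivable F (pt3 a x y) (delta_mx 0 i)) ->
  (forall i, unit_partials ('D_(delta_mx 0 i) F)) ->
  -3%:R < a < 1 ->
  `|x - x0| <= m -> `|x' - x0| <= m -> `|y - y0| <= m -> `|y' - y0| <= m ->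
  `|x - x'| <= d -> `|y - y'| <= d ->
  `|(F (pt3 a x y) : R) - F (pt3 a x' y') -
    (('D_(delta_mx 0 1) F (pt3 a x0 y0) : R) * (x - x') +
     ('D_(delta_mx 0 2%:R) F (pt3 a x0 y0) : R) * (y - y'))| <= 4 * m * d.
Proof.
move=> dF uF ha hx hx' hy hy' hd hd'.
have [_ l1 _] := pt3_line a 0 y.
have [_ _ l2] := pt3_line a x' 0.
have [|r hr E1] := @line_mean_value R F (delta_mx 0 1) (fun t => pt3 a t y) x x' l1.
  by move=> s _; exact: dF.
have [|s hs E2] := @line_mean_value R F (delta_mx 0 2%:R) (fun t => pt3 a x' t) y y' l2.
  by move=> s _; exact: dF.
have r1 := between_dist hr hx hx'; have s1 := between_dist hs hy hy'.
have k1 := unit_partials_lipschitz r x0 y y0 (uF 1) ha ha.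
have k2 := unit_partials_lipschitz x' x0 s y0 (uF 2%:R) ha ha.
rewrite subrr normr0 !add0r in k1; rewrite subrr normr0 !add0r in k2.
set p := ('D_(delta_mx 0 1) F (pt3 a x0 y0) : R) in k1 *.
set q := ('D_(delta_mx 0 2%:R) F (pt3 a x0 y0) : R) in k2 *.
have -> : (F (pt3 a x y) : R) - F (pt3 a x' y') - (p * (x - x') + q * (y - y')) =
   (('D_(delta_mx 0 1) F (pt3 a r y) : R) - p) * (x - x') +
   (('D_(delta_mx 0 2%:R) F (pt3 a x' s) : R) - q) * (y - y').
  have -> : (F (pt3 a x y) : R) - F (pt3 a x' y') =
    ((F (pt3 a x y) : R) - F (pt3 a x' y)) + ((F (pt3 a x' y) : R) - F (pt3 a x' y')).
    by ring.
  by rewrite E1 E2; ring.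
apply: (le_trans (ler_normD _ _)); rewrite !normrM.
have -> : 4 * m * d = (m + m) * d + (m + m) * d by ring.
by apply: lerD; apply: ler_pM => //; [apply: (le_trans k1)|apply: (le_trans k2)];
  exact: lerD.
Qed.

Lemma quadratic_differentiable {R : realType} (V W : normedModType R)
    (g : V -> W) (z : V) (c : R) (D : {linear V -> W}) (k : R) :
  (forall v, `|D v| <= k * `|v|) ->
  (forall w, `|g w - g z - D (w - z)| <= c * `|w - z| * `|w - z|) ->
  differentiable g z /\ 'd g z = D :> (V -> W).
Proof.
move=> hk hq.
have cD : continuous D.
  apply: bounded_linear_continuous; apply/linear_boundedP.
  exists (Num.max k 0); split; first exact: num_real.
  move=> r hr v; apply: (le_trans (hk v)); apply: ler_wpM2r => //.
  by apply: ltW; apply: le_lt_trans hr; rewrite le_max lexx.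
have hr : (fun v => g (v + z) - g z - D v) =o_ (0 : V) id.
  apply/eqoP => _ /posnumP[eps]; near=> v.
  have := hq (v + z); rewrite addrK => h; apply: (le_trans h).
  apply: ler_wpM2r => //.
  have c1 : 0 < `|c| + 1 by rewrite ltr_wpDl.
  have : `|v| <= eps%:num / (`|c| + 1).
    near: v; apply/nbhs_ballP; exists (eps%:num / (`|c| + 1)) => /=.
      by rewrite divr_gt0.
    by move=> v; rewrite -ball_normE /= sub0r normrN => /ltW.
  rewrite ler_pdivlMr // => h2.
  apply: le_trans h2; rewrite mulrC; apply: ler_wpM2l => //.
  by apply: (le_trans (ler_norm c)); rewrite lerDl.
have E : g \o shift z = cst (g z) + D +o_ 0 id.
  apply/eqaddoE; rewrite funeqE => v /=.
  have -> : g (v + z) = cst (g z) v + D v + (g (v + z) - g z - D v).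
    by rewrite /= -[X in _ = _ + X]addrA -opprD [RHS]addrC subrK.
  by congr (_ + _); rewrite -[LHS]/((fun v => g (v + z) - g z - D v) v) hr.
have dE := diff_unique cD E.
by split => //; apply/diff_locallyP; rewrite dE.
Unshelve. all: by end_near.
Qed.

Lemma quadratic_abscissa_remainder {R : realType}
    (x x' x0 y y' a F F' p q m d : R) :
  `|x - x0| <= m -> `|x' - x0| <= m -> `|x - x'| <= d ->
  `|F - F' - (p * (x - x') + q * (y - y'))| <= 4 * m * d ->
  `|x ^+ 2 + a + y + F - (x' ^+ 2 + a + y' + F') -
    ((x - x') * (2 * x0 + p) + (y - y') * (1 + q))| <= 6 * m * d.
Proof.
move=> hx hx' hd; set X := (X in `|X| <= _) => hX.
rewrite (_ : _ - _ = X + (x - x') * ((x - x0) + (x' - x0))); last by rewrite /X; ring.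
have q1 : `|(x - x') * ((x - x0) + (x' - x0))| <= d * (m + m).
  rewrite normrM; apply: ler_pM => //.
  by apply: (le_trans (ler_normD _ _)); exact: lerD.
by apply: (le_trans (ler_normD _ _)); clearbody X; lra.
Qed.

Lemma quadratic_ordinate_remainder {R : realType}
    (x x' y y' F F' p q m d b : R) :
  `|F - F' - (p * (x - x') + q * (y - y'))| <= 4 * m * d ->
  `|b * x + b * F - (b * x' + b * F') -
    ((x - x') * (b + b * p) + (y - y') * (b * q))| <= `|b| * (4 * m * d).
Proof.
set X := (X in `|X| <= _) => hX.
rewrite (_ : _ - _ = b * X); last by rewrite /X; ring.
by rewrite normrM; apply: ler_wpM2l.
Qed.

Lemma two_products {R : realType} (v w p q n e : R) :
  `|v| <= n -> `|w| <= n -> `|p| <= e -> `|q| <= e -> `|v * p + w * q| <= 2 * n * e.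
Proof.
move=> hv hw hp hq; apply: (le_trans (ler_normD _ _)); rewrite !normrM.
have : `|v| * `|p| <= n * e by exact: ler_pM.
have : `|w| * `|q| <= n * e by exact: ler_pM.
lra.
Qed.

(** The derivative of [f a] at [z] is exhibited as an explicit matrix [M a z]; the
    quadratic remainder estimate shows that it is the differential, and the
    Lipschitz bound on the partial derivatives of the perturbation gives the last
    estimate. *)
Lemma henon_estimates {R : realType} (b : R) (f : R -> 'rV[R]_2 -> 'rV[R]_2) :
  henon_like 4 1 b f -> exists2 c, 0 <= c &
  [/\ forall a x, -3%:R < a < 1 -> differentiable (f a) x,
      forall a, -3%:R < a < 1 -> quad_approx c (f a) &
      forall a a' z z' v, -3%:R < a < 1 -> -3%:R < a' < 1 ->
        `|'d (f a) z v - 'd (f a') z' v| <= c * (`|a - a'| + `|z - z'|) * `|v|].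
Proof.
move=> [A [B [cA cB nA nB fE]]].
have dom a x y : -3%:R < a < 1 ->
    joint_set `]-3%:R, 1[ (fun=> setT) (pt3 a x y).
  by move=> ha; have [h0 h1 h2] := pt3E a x y; split=> //=; rewrite h0 in_itv.
have jE (G : R -> 'rV[R]_2 -> R) a x y : joint G (pt3 a x y) = G a (pt x y).
  by rewrite /joint; have [-> -> ->] := pt3E a x y.
pose FA := joint A : 'rV[R]_3 -> R^o; pose FB := joint B : 'rV[R]_3 -> R^o.
have dA i a x y : -3%:R < a < 1 -> derivable FA (pt3 a x y) (delta_mx 0 i).
  by move=> ha; apply: (cA.1 [::]) => //; exact: dom.
have dB i a x y : -3%:R < a < 1 -> derivable FB (pt3 a x y) (delta_mx 0 i).
  by move=> ha; apply: (cB.1 [::]) => //; exact: dom.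
have uA i : unit_partials ('D_(delta_mx 0 i) FA).
  move=> j a x y ha; split; first by apply: (cA.1 [:: i]) => //; exact: dom.
  by apply: (nA [:: j; i]) => //; exact: dom.
have uB i : unit_partials ('D_(delta_mx 0 i) FB).
  move=> j a x y ha; split; first by apply: (cB.1 [:: i]) => //; exact: dom.
  by apply: (nB [:: j; i]) => //; exact: dom.
pose P F i a (z : 'rV[R]_2) : R :=
  'D_(delta_mx 0 i) (F : 'rV[R]_3 -> R^o) (pt3 a (z 0 0) (z 0 1)).
pose M a (z : 'rV[R]_2) : 'M[R]_2 := \matrix_(i < 2, j < 2)
  (if i == 0 then (if j == 0 then 2 * z 0 0 + P FA 1 a z else b + b * P FB 1 a z)
   else (if j == 0 then 1 + P FA 2%:R a z else b * P FB 2%:R a z)).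
have ME a z (v : 'rV[R]_2) :
    (v *m M a z) 0 0 = v 0 0 * (2 * z 0 0 + P FA 1 a z) + v 0 1 * (1 + P FA 2%:R a z) /\
    (v *m M a z) 0 1 = v 0 0 * (b + b * P FB 1 a z) + v 0 1 * (b * P FB 2%:R a z).
  have o1 : lift ord0 ord0 = 1 :> 'I_2 by apply/val_inj.
  have o0 : ord0 = 0 :> 'I_2 by apply/val_inj.
  by split; rewrite mxE 2!big_ord_recl big_ord0 addr0 o1 o0 !mxE.
have hA := fun a x x' x0 y y' y0 m d => @quadratic_remainder R FA a x x' x0 y y' y0 m d dA uA.
have hB := fun a x x' x0 y y' y0 m d => @quadratic_remainder R FB a x x' x0 y y' y0 m d dB uB.
have f0 a (z : 'rV[R]_2) : -3%:R < a < 1 ->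
    f a z 0 0 = z 0 0 ^+ 2 + a + z 0 1 + FA (pt3 a (z 0 0) (z 0 1)) /\
    f a z 0 1 = b * z 0 0 + b * FB (pt3 a (z 0 0) (z 0 1)).
  move=> ha; rewrite /FA /FB !jE -(pt_eta z).
  have := fE a (z 0 0) (z 0 1); rewrite -(pt_eta z) in_itv /= => -> //.
  set p := pt _ _; set q := pt _ _.
  have pq (u v : 'rV[R]_2) i : (u + v) 0 i = u 0 i + v 0 i by rewrite mxE.
  by rewrite !pq /p /q; split; [rewrite !(ptE _ _).1|rewrite !(ptE _ _).2].
have nz (v : 'rV[R]_2) : `|v 0 0| <= `|v| /\ `|v 0 1| <= `|v|.
  by rewrite row2_norm !le_max !lexx orbT.
have sub (u v : 'rV[R]_2) i : (u - v) 0 i = u 0 i - v 0 i by rewrite !mxE.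
have pd F i a a' z z' : (forall i, unit_partials ('D_(delta_mx 0 i) F)) ->
    -3%:R < a < 1 -> -3%:R < a' < 1 ->
    `|P F i a z - P F i a' z'| <= `|a - a'| + 2 * `|z - z'|.
  move=> uF ha ha'; have [z0 z1] := nz (z - z'); rewrite !sub in z0 z1.
  have h := unit_partials_lipschitz (z 0 0) (z' 0 0) (z 0 1) (z' 0 1) (uF i) ha ha'.
  by apply: (le_trans h); rewrite -addrA lerD2l; lra.
have {}hA a (w w' z : 'rV[R]_2) m d (ha : -3%:R < a < 1) := hA a
  (w 0 0) (w' 0 0) (z 0 0) (w 0 1) (w' 0 1) (z 0 1) m d ha.
have {}hB a (w w' z : 'rV[R]_2) m d (ha : -3%:R < a < 1) := hB a
  (w 0 0) (w' 0 0) (z 0 0) (w 0 1) (w' 0 1) (z 0 1) m d ha.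
change (forall a (w w' z : 'rV[R]_2) m d, -3%:R < a < 1 ->
  `|w 0 0 - z 0 0| <= m -> `|w' 0 0 - z 0 0| <= m ->
  `|w 0 1 - z 0 1| <= m -> `|w' 0 1 - z 0 1| <= m ->
  `|w 0 0 - w' 0 0| <= d -> `|w 0 1 - w' 0 1| <= d ->
  `|(FA (pt3 a (w 0 0) (w 0 1)) : R) - FA (pt3 a (w' 0 0) (w' 0 1)) -
    (P FA 1 a z * (w 0 0 - w' 0 0) + P FA 2%:R a z * (w 0 1 - w' 0 1))| <= 4 * m * d) in hA.
change (forall a (w w' z : 'rV[R]_2) m d, -3%:R < a < 1 ->
  `|w 0 0 - z 0 0| <= m -> `|w' 0 0 - z 0 0| <= m ->
  `|w 0 1 - z 0 1| <= m -> `|w' 0 1 - z 0 1| <= m ->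
  `|w 0 0 - w' 0 0| <= d -> `|w 0 1 - w' 0 1| <= d ->
  `|(FB (pt3 a (w 0 0) (w 0 1)) : R) - FB (pt3 a (w' 0 0) (w' 0 1)) -
    (P FB 1 a z * (w 0 0 - w' 0 0) + P FB 2%:R a z * (w 0 1 - w' 0 1))| <= 4 * m * d) in hB.
have pdA i a a' z z' ha ha' := pd FA i a a' z z' uA ha ha'.
have pdB i a a' z z' ha ha' := pd FB i a a' z z' uB ha ha'.
(* From here on, only these bounds on [P] and the entries [ME] of [M] matter. *)
clear pd; clearbody M; clearbody P.
pose c := 8 + 4 * `|b|; have c0 : 0 <= c by rewrite /c addr_ge0 // mulr_ge0.
have b0 := normr_ge0 b.
have quad a z w w' : -3%:R < a < 1 ->
    `|f a w - f a w' - (w - w') *m M a z| <=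
    c * Num.max `|w - z| `|w' - z| * `|w - w'|.
  move=> ha; set m := Num.max _ _; set d := `|w - w'|.
  have m0 : 0 <= m by rewrite le_max normr_ge0.
  have d0 : 0 <= d by rewrite /d.
  have cm (u : 'rV[R]_2) : `|u - z| <= m -> `|u 0 0 - z 0 0| <= m /\ `|u 0 1 - z 0 1| <= m.
    move=> hu; have [h1 h2] := nz (u - z); rewrite !sub in h1 h2.
    by split; [exact: (le_trans h1)|exact: (le_trans h2)].
  have [a1 a2] : `|w 0 0 - z 0 0| <= m /\ `|w 0 1 - z 0 1| <= m.
    by apply: cm; rewrite /m le_max lexx.
  have [b1 b2] : `|w' 0 0 - z 0 0| <= m /\ `|w' 0 1 - z 0 1| <= m.
    by apply: cm; rewrite /m le_max lexx orbT.
  have [d1 d2] : `|w 0 0 - w' 0 0| <= d /\ `|w 0 1 - w' 0 1| <= d.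
    by have := nz (w - w'); rewrite !sub.
  have qA := hA a w w' z m d ha a1 b1 a2 b2 d1 d2.
  have qB := hB a w w' z m d ha a1 b1 a2 b2 d1 d2.
  have [M0 M1] := ME a z (w - w'); rewrite !sub in M0 M1.
  have [fw0 fw1] := f0 a w ha; have [fv0 fv1] := f0 a w' ha.
  have md : 0 <= m * d by exact: mulr_ge0.
  rewrite row2_norm ge_max !(sub (_ - _)) !(sub (f a w)) M0 M1 fw0 fw1 fv0 fv1.
  clearbody m d; clear -qA qB a1 b1 d1 md b0; apply/andP; split.
    apply: (le_trans (quadratic_abscissa_remainder a a1 b1 d1 qA)).
    by rewrite -!mulrA; apply: ler_wpM2r => //; rewrite /c; lra.
  apply: (le_trans (quadratic_ordinate_remainder b qB)).
  rewrite -!mulrA [leLHS]mulrA; apply: ler_wpM2r => //.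
  by rewrite /c mulrC; lra.
have lip a a' z z' (v : 'rV[R]_2) : -3%:R < a < 1 -> -3%:R < a' < 1 ->
    `|v *m M a z - v *m M a' z'| <= c * (`|a - a'| + `|z - z'|) * `|v|.
  move=> ha ha'.
  have [z0 z1] := nz (z - z'); rewrite !sub in z0 z1.
  have [v0 v1] := nz v.
  have [M0 M1] := ME a z v; have [M0' M1'] := ME a' z' v.
  have A1 := pdA 1 a a' z z' ha ha'; have A2 := pdA 2%:R a a' z z' ha ha'.
  have B1 := pdB 1 a a' z z' ha ha'; have B2 := pdB 2%:R a a' z z' ha ha'.
  rewrite row2_norm ge_max !sub M0 M1 M0' M1'.
  move: A1 A2 B1 B2 z0 z1 v0 v1 (normr_ge0 (a - a')) (normr_ge0 (z - z')) (normr_ge0 v).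
  move: `|a - a'| `|z - z'| `|v| (v 0 0) (v 0 1) (z 0 0) (z' 0 0) (z 0 1) (z' 0 1).
  move: (P FA 1 a z) (P FA 1 a' z') (P FA 2%:R a z) (P FA 2%:R a' z').
  move: (P FB 1 a z) (P FB 1 a' z') (P FB 2%:R a z) (P FB 2%:R a' z').
  rewrite /c; move: b0; clear.
  move=> b0 p p' q q' k k' l l' s r n v w x x' y y' A1 A2 B1 B2 hx hy hv hw s0 r0 n0.
  apply/andP; split.
    rewrite (_ : _ - _ = (v * (2 * (x - x')) + w * 0) + (v * (k - k') + w * (l - l')));
      last by ring.
    apply: (le_trans (ler_normD _ _)).
    have h1 : `|v * (2 * (x - x')) + w * 0| <= 2 * n * (2 * r).
      apply: two_products => //; rewrite ?normr0 ?mulr_ge0 //.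
      by rewrite normrM ger0_norm //; apply: ler_wpM2l.
    have h2 := two_products hv hw A1 A2.
    have : 0 <= `|b| * (s * n) by rewrite !mulr_ge0.
    have : 0 <= `|b| * (r * n) by rewrite !mulr_ge0.
    have : 0 <= s * n by rewrite !mulr_ge0.
    lra.
  rewrite (_ : _ - _ = b * (v * (p - p') + w * (q - q'))); last by ring.
  rewrite normrM.
  have h2 := ler_wpM2l b0 (two_products hv hw B1 B2).
  have : 0 <= `|b| * (s * n) by rewrite !mulr_ge0.
  have : 0 <= s * n by rewrite !mulr_ge0.
  have : 0 <= r * n by rewrite !mulr_ge0.
  lra.
have bound a z (v : 'rV[R]_2) : `|v *m M a z| <= (\sum_i \sum_j `|M a z i j|) * `|v|.
  rewrite row2_norm ge_max; have [v0 v1] := nz v.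
  have k (j : 'I_2) : `|(v *m M a z) 0 j| <= (\sum_i \sum_j `|M a z i j|) * `|v|.
    rewrite mxE; apply: (le_trans (ler_norm_sum _ _ _)).
    rewrite mulr_suml; apply: ler_sum => i _; rewrite normrM mulrC.
    apply: ler_pM => //; last by rewrite [leRHS]mx_normrE;
      exact: (le_bigmax_cond _ (fun ij : 'I_1 * 'I_2 => `|v ij.1 ij.2|) (j := (0, i))).
    by rewrite (bigD1 j) //= lerDl sumr_ge0.
  by rewrite !k.
have df a z : -3%:R < a < 1 -> differentiable (f a) z /\
    'd (f a) z = mulmxr (M a z) :> ('rV[R]_2 -> 'rV[R]_2).
  move=> ha; apply: (@quadratic_differentiable R _ _ (f a) z c (mulmxr (M a z))
     (\sum_i \sum_j `|M a z i j|)).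
    by move=> v /=; exact: bound.
  move=> w; have := quad a z w z ha; rewrite subrr normr0.
  by rewrite (@max_l _ _ `|w - z|).
exists c => //; split.
- by move=> a x /df h; have [] := h x.
- by move=> a ha z w w'; have [_ ->] := df a z ha; exact: quad.
- move=> a a' z z' v ha ha'; have [_ E] := df a z ha; have [_ E'] := df a' z' ha'.
  have e1 : 'd (f a) z v = v *m M a z := congr1 (fun h => h v) E.
  have e2 : 'd (f a') z' v = v *m M a' z' := congr1 (fun h => h v) E'.
  apply: (eq_ind_r (fun u => `|u - _| <= _) _ e1).
  by apply: (eq_ind_r (fun u => `|_ - u| <= _) _ e2); exact: lip.
Qed.

(** * Limsup sets with summable diameters *)

Definition bounded_sums {R : realType} {T : choiceType} (Z : set T) (w : T -> R) : Prop :=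
  exists B : R, forall zs : seq T, uniq zs -> (forall z, z \in zs -> Z z) ->
    \sum_(z <- zs) w z <= B.

Lemma bounded_sums_tail {R : realType} {T : choiceType} (Z : set T) (w : T -> R) (d : R) :
  bounded_sums Z w -> 0 < d ->
  exists xs : seq T, forall ys, uniq ys -> (forall z, z \in ys -> Z z /\ z \notin xs) ->
    \sum_(z <- ys) w z <= d.
Proof.
move=> [B hB] d0.
pose S := [set r | exists zs : seq T,
  [/\ uniq zs, forall z, z \in zs -> Z z & r = \sum_(z <- zs) w z]].
have S0 : S !=set0 by exists 0, [::]; split => //; rewrite big_nil.
have ubS : has_ubound S by exists B => _ [zs [h1 h2 ->]]; exact: hB.
have [_ [xs [uxs hxs ->]] hsup] := sup_adherent d0 (conj S0 ubS).
exists xs => ys uys hys.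
have : \sum_(z <- xs ++ ys) w z <= sup S.
  apply: ub_le_sup => //; exists (xs ++ ys); split => //.
    rewrite cat_uniq uxs uys andbT; apply/hasPn => z /hys[_].
    exact.
  by move=> z; rewrite mem_cat => /orP[/hxs//|/hys[]].
by rewrite big_cat /=; lra.
Qed.

(** Outside the union of the exceptional finite sets of [bounded_sums_tail] for
    all [1 / n], a term would be smaller than every [1 / n]. *)
Lemma bounded_sums_countable {R : realType} {T : choiceType} (Z : set T) (w : T -> R) :
  (forall z, Z z -> 0 < w z) -> bounded_sums Z w -> countable Z.
Proof.
move=> w0 bw.
have hn (n : nat) : exists xs : seq T, forall ys, uniq ys ->
    (forall z, z \in ys -> Z z /\ z \notin xs) -> \sum_(z <- ys) w z <= n.+1%:R^-1.
  exact: (bounded_sums_tail bw).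
have [X hX] := @boolp.choice _ _ _ hn.
apply: (@sub_countable _ _ _ (\bigcup_(n in [set: nat]) [set` X n])); last first.
  by apply: bigcup_countable => // n _; apply: finite_set_countable.
apply: subset_card_le => z Zz; apply: contrapT => nz.
have zn n : z \notin X n by apply/negP => h; apply: nz; exists n.
have wn n : w z <= n.+1%:R^-1.
  have := hX n [:: z] isT; rewrite big_seq1; apply => y.
  by rewrite inE => /eqP ->.
have [n nlt] := ltr_add_invr (w0 z Zz : 0 < w z).
by have := wn n; rewrite add0r in nlt; rewrite leNgt nlt.
Qed.

Lemma countable_enumeration {T : choiceType} (Z : set T) : countable Z ->
  exists (enu : nat -> option T) (j : T -> nat),
    ocancel enu j /\ forall z, Z z <-> enu (j z) = Some z.
Proof.
move=> /countable_injP[j inj].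
have /(@boolp.choice nat (option T) (fun n o => (forall z, o = Some z -> Z z /\ j z = n) /\
    forall z, Z z -> j z = n -> o = Some z))[enu henu] : forall n, exists o,
    (forall z, o = Some z -> Z z /\ j z = n) /\
    forall z, Z z -> j z = n -> o = Some z.
  move=> n; have [[z [Zz jz]]|nz] := pselect (exists z, Z z /\ j z = n).
    exists (Some z); split=> [_ [<-] //|y Zy jy].
    by congr Some; apply: inj; rewrite ?inE // jz jy.
  by exists None; split => // z Zz jz; case: nz; exists z.
exists enu, j; split.
  by move=> n; case E : (enu n) => [z|] //=; have [_ ->] := (henu n).1 z E.
move=> z; split=> [Zz|/((henu (j z)).1 z)[]//].
exact: (henu (j z)).2.
Qed.

Lemma sum_pmap {R : realType} {T : choiceType} (enu : nat -> option T) (w : T -> R)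
    (s : seq nat) :
  \sum_(i <- s) oapp w 0 (enu i) = \sum_(z <- pmap enu s) w z.
Proof.
elim: s => [|i s IH]; first by rewrite !big_nil.
rewrite big_cons IH /=; case: (enu i) => [z|] /=; first by rewrite big_cons.
by rewrite add0r.
Qed.

Lemma bounded_partial_sums {R : realType} {T : choiceType} (Z : set T) (w : T -> R)
    (enu : nat -> option T) (j : T -> nat) (d : R) :
  (forall z, Z z -> 0 <= w z) ->
  (forall zs, uniq zs -> (forall z, z \in zs -> Z z) -> \sum_(z <- zs) w z <= d) ->
  ocancel enu j -> (forall z, Z z <-> enu (j z) = Some z) ->
  (\sum_(0 <= i <oo) (oapp w 0 (enu i))%:E <= d%:E)%E.
Proof.
move=> w0 hd enuK hZ.
have hz i z : enu i = Some z -> Z z.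
  by move=> E; apply/hZ; have := enuK i; rewrite E /= => ->.
have o0 i : 0 <= oapp w 0 (enu i).
  by case E : (enu i) => [z|] //=; exact/w0/(hz i).
apply: lime_le.
  by apply: is_cvg_nneseries => n _ _; rewrite lee_fin.
apply: nearW => n; rewrite sumEFin lee_fin sum_pmap; apply: hd.
  by apply: (pmap_uniq enuK); exact: iota_uniq.
by move=> z; rewrite mem_pmap => /mapP[i _ /esym]; exact: hz.
Qed.

Lemma diam_le {R : realType} (U : set R) (r : R) :
  (forall a b, U a -> U b -> `|a - b| <= r) -> (diam U <= r%:E)%E.
Proof.
move=> h; apply: ge_ereal_sup => _ [[a b] [/= Ua Ub] <-].
by rewrite lee_fin; exact: h.
Qed.

Lemma diam_pow_le {R : realType} (s r : R) (U : set R) : 0 <= s -> 0 <= r ->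
  (forall a b, U a -> U b -> `|a - b| <= r) -> (diam_pow s U <= (r `^ s)%:E)%E.
Proof.
move=> s0 r0 h; rewrite /diam_pow; case: ifPn => [_|/set0P[a Ua]].
  by rewrite lee_fin powR_ge0.
rewrite -poweR_EFin; apply: gt0_ler_poweR => //; last exact: diam_le.
  rewrite in_itv /= leey andbT; apply: (@le_trans _ _ (`|a - a|)%:E).
    by rewrite lee_fin.
  by apply: ereal_sup_ubound; exists (a, a).
by rewrite in_itv /= lee_fin r0 leey.
Qed.

Lemma diam_pow_ge0 {R : realType} (s : R) (U : set R) : (0 <= diam_pow s U)%E.
Proof. by rewrite /diam_pow; case: ifP => // _; exact: poweR_ge0. Qed.

(** Removing finitely many indices from [Z] makes the sum as small as desired,
    and the remaining sets still cover [X], each of whose points lies in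
    infinitely many [I z].  The smallness of the sum also makes every
    diameter small. *)
Lemma limsup_hausdorff_measure0 {R : realType} {T : choiceType} (Z : set T)
    (I : T -> set R) (r : T -> R) (s : R) (X : set R) :
  0 < s -> (forall z, Z z -> 0 < r z) ->
  (forall z a b, Z z -> I z a -> I z b -> `|a - b| <= r z) ->
  bounded_sums Z (fun z => r z `^ s) ->
  (forall a, X a -> infinite_set [set z | Z z /\ I z a]) ->
  hausdorff_measure s X = 0%E.
Proof.
move=> s0 r0 hI bs hX.
have content0 e : 0 < e -> hausdorff_content s e X = 0%E.
  move=> e0; apply/eqP; rewrite eq_le; apply/andP; split; last first.
    apply: le_ereal_inf_tmp => _ [U _ <-]; apply: nneseries_ge0 => i _ _.
    exact: diam_pow_ge0.
  apply/lee_addgt0Pr => d d0; rewrite add0e.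
  pose d' := Num.min d (e `^ s).
  have d'0 : 0 < d' by rewrite lt_min d0 powR_gt0.
  have [xs hxs] := bounded_sums_tail bs d'0.
  pose Z' := [set z | Z z /\ z \notin xs].
  have cZ' : countable Z'.
    apply: (@sub_countable _ _ _ Z); first by apply: subset_card_le => z [].
    by apply: (bounded_sums_countable _ bs) => z Zz; exact/powR_gt0/r0.
  have [enu [j [enuK hZ']]] := countable_enumeration cZ'.
  have hz i z : enu i = Some z -> Z' z.
    by move=> E; apply/hZ'; have := enuK i; rewrite E /= => ->.
  pose U i := oapp I set0 (enu i).
  apply: (@le_trans _ _ (\sum_(0 <= i <oo) diam_pow s (U i))%E).
    apply: ereal_inf_lbound; exists U => //; split.
      move=> i; rewrite /U; case E : (enu i) => [z|] /=; last first.
        by apply: diam_le => a b [].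
      have [Zz zxs] := hz i z E.
      apply: (@le_trans _ _ (r z)%:E); first by apply: diam_le => a b; exact: hI.
      rewrite lee_fin leNgt; apply/negP => er.
      have : r z `^ s <= d'.
        have := hxs [:: z] isT; rewrite big_seq1; apply => y.
        by rewrite inE => /eqP ->.
      rewrite leNgt => /negP; apply.
      apply: (@le_lt_trans _ _ (e `^ s)); first by rewrite /d' ge_min lexx orbT.
      by apply: gt0_ltr_powR; rewrite ?nnegrE ?ltW // r0.
    move=> a Xa; have [z [[Zz Iz] zxs]] :
        ([set z | Z z /\ I z a] `\` [set` xs]) !=set0.
      apply: infinite_setN0; apply: infinite_setD; first exact: hX.
      exact: finite_seq.
    have Z'z : Z' z by split => //; apply/negP.
    exists (j z) => //; rewrite /U.
    by move/hZ': Z'z => ->.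
  apply: (@le_trans _ _ (\sum_(0 <= i <oo) (oapp (fun z => r z `^ s) 0 (enu i))%:E)%E).
    apply: lee_nneseries => [i _ _|i _]; first exact: diam_pow_ge0.
    rewrite /U; case E : (enu i) => [z|] /=; last by rewrite /diam_pow eqxx.
    have [Zz _] := hz i z E.
    by apply: diam_pow_le; [exact: ltW|exact/ltW/r0|move=> a b; exact: hI].
  apply: (@le_trans _ _ d'%:E); last by rewrite lee_fin /d' ge_min lexx.
  apply: (@bounded_partial_sums _ _ Z') => //.
  by move=> z _; exact: powR_ge0.
apply/eqP; rewrite eq_le; apply/andP; split.
  by apply: ge_ereal_sup => _ [e /= e0 <-]; rewrite content0.
by apply: ereal_sup_ubound; exists 1 => /=; rewrite ?content0.
Qed.

(** The Borel-Cantelli lemma, for the sets [I z] enumerated by their countable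
    index set. *)
Lemma limsup_negligible {R : realType} {T : choiceType} (Z : set T)
    (I : T -> set R) (r : T -> R) (X : set R) :
  (forall z, Z z -> 0 < r z) -> (forall z, Z z -> is_interval (I z)) ->
  (forall z a b, Z z -> I z a -> I z b -> `|a - b| <= r z) ->
  bounded_sums Z r ->
  (forall a, X a -> infinite_set [set z | Z z /\ I z a]) ->
  (@lebesgue_measure R).-negligible X.
Proof.
move=> r0 itv hI bs hX.
have [enu [j [enuK hZ]]] := countable_enumeration (bounded_sums_countable r0 bs).
have hz i z : enu i = Some z -> Z z.
  by move=> E; apply/hZ; have := enuK i; rewrite E /= => ->.
pose F i := oapp I set0 (enu i).
have mF k : measurable (F k).
  rewrite /F; case E : (enu k) => [z|] /=; last exact: measurable0.
  by apply: is_interval_measurable; exact/itv/(hz k).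
exists (lim_sup_set F); split.
- by apply: bigcapT_measurable => k; apply: bigcup_measurable => i _; exact: mF.
- apply: lim_sup_set_cvg0 => //.
  have [B hB] := bs.
  apply: (@le_lt_trans _ _ (2 * B)%:E); last exact: ltry.
  apply: (@le_trans _ _ (\sum_(0 <= i <oo) (oapp (fun z => 2 * r z) 0 (enu i))%:E)%E).
    apply: lee_nneseries => [i _ _|i _]; first exact: measure_ge0.
    rewrite /F; case E : (enu i) => [z|] /=; last by rewrite measure0.
    have Zz := hz i z E.
    have [->|/set0P[a Ia]] := eqVneq (I z) set0.
      by rewrite measure0 lee_fin mulr_ge0 // ltW // r0.
    apply: (@le_trans _ _ (lebesgue_measure (`[a - r z, a + r z]%classic : set R))).
      apply: le_measure; rewrite ?inE //=.
        by apply: is_interval_measurable; exact: itv.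
      move=> b Ib; rewrite /= in_itv /=.
      by have := hI z b a Zz Ib Ia; rewrite ler_norml => /andP[]; lra.
    rewrite lebesgue_measure_itv /= lte_fin; case: ifP => _.
      by rewrite -EFinD lee_fin; lra.
    by rewrite lee_fin mulr_ge0 // ltW // r0.
  apply: (@bounded_partial_sums _ _ Z) => //.
    by move=> z Zz; rewrite mulr_ge0 // ltW // r0.
  by move=> zs u h; rewrite -mulr_sumr ler_pM2l // hB.
move=> a Xa n _; apply: contrapT => nF.
apply: (hX a Xa); apply: (@sub_finite_set _ _ [set` pmap enu (iota 0 n)]).
  move=> z [Zz Iz] /=; rewrite mem_pmap; apply/mapP; exists (j z).
    rewrite mem_iota add0n /= ltnNge; apply/negP => nj; apply: nF.
    by exists (j z) => //; rewrite /F; move/hZ: Zz => ->.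
  by move/hZ: Zz.
exact: finite_seq.
Qed.

Lemma hausdorff_dim_le {R : realType} (s : R) (X : set R) : 0 <= s ->
  (forall s', s < s' -> hausdorff_measure s' X = 0%E) ->
  (hausdorff_dim X <= s%:E)%E.
Proof.
move=> s0 h; apply/lee_addgt0Pr => e e0; rewrite -EFinD.
by apply: ereal_inf_lbound; exists (s + e) => //=; split; [lra|apply: h; lra].
Qed.

(** * Hyperbolic continuations and uniformity in the parameter *)

Lemma continuation_near {R : realType} (K : set 'rV[R]_2) (J : set R)
    (h : R -> 'rV[R]_2 -> 'rV[R]_2) (a1 kap : R) (x : 'rV[R]_2) :
  {within J `*` K, continuous (fun az : R * 'rV[R]_2 => h az.1 az.2)} ->
  J a1 -> K x -> 0 < kap ->
  exists U : set R, exists W : set 'rV[R]_2, [/\ nbhs a1 U, nbhs x W &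
    forall a z, U a -> W z -> J a -> K z -> `|h a1 x - h a z| <= kap].
Proof.
move=> /subspace_continuousP cont Ja Kx kap0.
have := cont (a1, x) (conj Ja Kx).
move=> /cvgrPdist_le /(_ kap kap0) /= [[U W] /= [nU nW] H].
by exists U, W; split => // a z Ua Wz Ja' Kz; exact: (H (a, z)).
Qed.

(** The tube lemma for the compact set [K]. *)
Lemma continuation_uniform {R : realType} (K : set 'rV[R]_2) (J : set R)
    (h : R -> 'rV[R]_2 -> 'rV[R]_2) (a1 kap : R) :
  compact K ->
  {within J `*` K, continuous (fun az : R * 'rV[R]_2 => h az.1 az.2)} ->
  J a1 -> 0 < kap ->
  exists2 d, 0 < d & forall a z, `|a - a1| < d -> J a -> K z ->
    `|h a z - h a1 z| <= kap.
Proof.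
move=> cK cont Ja kap0.
have k2 : 0 < kap / 2 by lra.
move/compact_near_coveringP/near_covering_withinP: cK.
move=> /(_ R (nbhs a1) (fun a z => J a -> `|h a z - h a1 z| <= kap)).
have near x : K x -> \forall x' \near x & a \near a1, K x' ->
    J a -> `|h a x' - h a1 x'| <= kap.
  move=> Kx; have [U [W [nU nW H]]] := continuation_near cont Ja Kx k2.
  exists (W, U) => //= -[z a] /= [Wz Ua] Kz Ja'.
  have h1 := H a z Ua Wz Ja' Kz.
  have h2 := H a1 z (nbhs_singleton nU) Wz Ja Kz.
  have -> : h a z - h a1 z = (h a1 x - h a1 z) - (h a1 x - h a z).
    by apply: row2P; rewrite !mxE; ring.
  by apply: (le_trans (ler_normB _ _)); lra.
move=> /(_ _ near) /nbhs_ballP [d /= d0 H].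
exists d => // a z ha Ja' Kz; apply: (H a) => //.
by rewrite -ball_normE /= distrC.
Qed.

Lemma continuation_bounded {R : realType} (K : set 'rV[R]_2) (J : set R)
    (h : R -> 'rV[R]_2 -> 'rV[R]_2) (a1 : R) :
  compact K ->
  {within J `*` K, continuous (fun az : R * 'rV[R]_2 => h az.1 az.2)} ->
  J a1 -> exists M, forall z, K z -> `|h a1 z| <= M.
Proof.
move=> cK cont Ja.
move/compact_near_coveringP/near_covering_withinP: cK.
move=> /(_ R (pinfty_nbhs R) (fun M z => `|h a1 z| <= M)).
have near x : K x -> \forall x' \near x & M \near +oo, K x' -> `|h a1 x'| <= M.
  move=> Kx; have [U [W [nU nW H]]] := continuation_near cont Ja Kx ltr01.
  exists (W, [set M | `|h a1 x| + 1 < M]) => /=.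
    by split => //; apply: nbhs_pinfty_gt; exact: num_real.
  move=> -[z M] /= [Wz hM] Kz.
  have h2 := H a1 z (nbhs_singleton nU) Wz Ja Kz.
  have -> : h a1 z = h a1 x - (h a1 x - h a1 z).
    by apply: row2P; rewrite !mxE; ring.
  by apply: (le_trans (ler_normB _ _)); apply: ltW; lra.
move=> /(_ _ near) [M0 [_ H]]; exists (M0 + 1).
by apply: H; lra.
Qed.

Lemma eigen_pseudo_tangent {R : realType} (F g : 'rV[R]_2 -> 'rV[R]_2)
    (x y : 'rV[R]_2) (p : nat) (eta s : R) :
  (forall z, differentiable F z) -> iter p F y = y ->
  (forall k v, `|'d F (iter k F y) v - 'd g (iter k g x) v| <= eta * `|v|) ->
  eigenvalue ('J (iter p F) y) s -> exists w, pseudo_tangent g x p eta s w.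
Proof.
move=> dF py close /eigenvalueP[v vE v0].
exists (fun k => 'd (iter k F) y v); split.
- move=> k; have E : 'd (iter k.+1 F) y v = 'd F (iter k F y) ('d (iter k F) y v).
    exact: diff_iterS.
  exact: (eq_ind_r (fun u => `|u - _| <= _) (close k _) E).
- elim=> [|k IH].
    have E0 : 'd (iter p F) y v = s *: v.
      exact: (eq_trans (esym (mul_rV_lin1 ('d (iter p F) y) v)) vE).
    exact: (eq_trans E0 (congr1 (fun u => s *: u) (esym (@diff_iter0 _ F y v)))).
  have E : 'd (iter (k.+1 + p) F) y v =
      'd F (iter (k + p) F y) ('d (iter (k + p) F) y v).
    by apply: (@diff_iterS _ F (k + p)).
  have E' : 'd (iter k.+1 F) y v = 'd F (iter k F y) ('d (iter k F) y v).
    exact: diff_iterS.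
  apply: (eq_trans E); apply: (eq_trans _ (congr1 (fun u => s *: u) (esym E'))).
  have py' : iter (k + p) F y = iter k F y by rewrite iterD py.
  apply: (eq_trans (congr1 (fun u => 'd F u ('d (iter (k + p) F) y v)) py')).
  apply: (eq_trans (congr1 ('d F (iter k F y)) IH)).
  exact: linearZ.
- exact: (eq_ind_r (fun u => u != 0) v0 (@diff_iter0 _ F y v)).
Qed.

(** Compactness of the segment: a sum over [Z] is at most the total of the sums
    over finitely many pieces of [Z], since the terms are nonnegative. *)
Lemma bounded_sums_cover {R : realType} {T : choiceType} (Z : set T) (w : T -> R)
    (u : T -> R) (a b : R) :
  (forall z, Z z -> 0 <= w z) -> (forall z, Z z -> u z \in `[a, b]) ->
  (forall c, c \in `[a, b] -> exists2 d, 0 < d &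
     bounded_sums [set z | Z z /\ `|u z - c| < d] w) ->
  bounded_sums Z w.
Proof.
move=> w0 hu loc.
have /(@boolp.choice _ _ (fun c (dS : R * R) => c \in `[a, b] -> 0 < dS.1 /\
   forall zs : seq T, uniq zs -> (forall z, z \in zs -> Z z /\ `|u z - c| < dS.1) ->
    \sum_(z <- zs) w z <= dS.2))[dS hdS] : forall c, exists dS : R * R,
   c \in `[a, b] -> 0 < dS.1 /\
   forall zs : seq T, uniq zs -> (forall z, z \in zs -> Z z /\ `|u z - c| < dS.1) ->
    \sum_(z <- zs) w z <= dS.2.
  move=> c; have [cab|nc] := boolP (c \in `[a, b]); last by exists (0, 0).
  by have [d d0 [B hB]] := loc c cab; exists (d, B).
have := @segment_compact R a b; rewrite compact_cover.
move=> /(_ R `[a, b]%classic (fun c => ball c (dS c).1)) [].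
- by move=> c _; exact: ball_open.
- move=> c cab; exists c => //; apply: ballxx.
  by have [] := hdS c cab.
move=> D' D'ab cov.
pose cs : seq R := finmap.enum_fset D'.
exists (\sum_(c <- cs) (dS c).2) => zs uzs hzs.
apply: (@le_trans _ _ (\sum_(z <- zs) \sum_(c <- cs | `|u z - c| < (dS c).1) w z)).
  rewrite big_seq [leRHS]big_seq; apply: ler_sum => z zzs.
  have Zz := hzs z zzs.
  have [c cD' /= hc] := cov (u z) (hu z Zz).
  rewrite (big_rem c) //=; rewrite -ball_normE /= distrC in hc; rewrite hc.
  by rewrite lerDl; apply: sumr_ge0 => c' _; exact: w0.
rewrite (exchange_big_dep predT) //= big_seq [leRHS]big_seq.
apply: ler_sum => c cD'; rewrite -big_filter.
have cab : c \in `[a, b] by have := D'ab c cD'; rewrite inE.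
have [_] := hdS c cab; apply; first exact: filter_uniq.
by move=> z; rewrite mem_filter => /andP[hz /hzs].
Qed.

(** For parameters [u z] close to [a1], the derivatives of [f (u z)] along the cycle
    of [h (u z) z] are uniformly close to those of [f a1] along the cycle of [h a1 z],
    so eigenvectors of the former are pseudo-tangent orbits for the latter. *)
Lemma local_multiplier_sum {R : realType} (b : R)
    (f : R -> 'rV[R]_2 -> 'rV[R]_2) (a0 a1 t : R) (K : set 'rV[R]_2) (J : set R)
    (h : R -> 'rV[R]_2 -> 'rV[R]_2) (Z : set 'rV[R]_2) (u : 'rV[R]_2 -> R)
    (p : 'rV[R]_2 -> nat) (s : 'rV[R]_2 -> R) :
  henon_like 4 1 b f -> compact K -> f a0 @` K = K ->
  hyperbolic_continuation f a0 K J h -> J a1 -> 1 < t ->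
  (forall z, Z z -> [/\ K z, J (u z), periodic_point (f a0) (p z) z, 1 < `|s z| &
     eigenvalue ('J (iter (p z) (f (u z))) (h (u z) z)) (s z) /\
     exists2 r, `|r| < 1 & eigenvalue ('J (iter (p z) (f (u z))) (h (u z) z)) r]) ->
  exists2 d, 0 < d &
    bounded_sums [set z | Z z /\ `|u z - a1| < d] (fun z => `|s z| `^ (- t)).
Proof.
move=> hen cK fK [[_ _ _ J31] _ cont conj hyp] Ja1 t1 hZ.
have [c c0 [df qf lf]] := henon_estimates hen.
have J13 a : J a -> -3%:R < a < 1 by move=> /J31; rewrite /= in_itv.
have KfK z : K z -> K (f a0 z) by move=> Kz; rewrite -fK; exists z.
have Kit k z : K z -> K (iter k (f a0) z).
  by move=> Kz; elim: k => [|k IH] //=; exact: KfK.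
have hit a k z : J a -> K z -> iter k (f a) (h a z) = h a (iter k (f a0) z).
  move=> Ja Kz; elim: k => [|k IH] //=; rewrite IH.
  by have [_ ->] := conj a Ja; last exact: Kit.
set g := f a1; pose X := h a1 @` K.
have dg x : differentiable g x by apply: df; exact: J13.
have gX x : X x -> X (g x).
  move=> [z Kz <-]; exists (f a0 z); first exact: KfK.
  by have [_ E] := conj a1 Ja1; rewrite /g E.
have [M hM] := continuation_bounded cK cont Ja1.
have XM x : X x -> `|x| <= M by move=> [z Kz <-]; exact: hM.
have [k k0 hk] := linear_lipschitz (diff_continuous (dg 0)).
pose L := Num.max 1 (k + c * M).
have hL x v : X x -> `|'d g x v| <= L * `|v|.
  move=> Xx; have h1 := lf a1 a1 x 0 v (J13 _ Ja1) (J13 _ Ja1).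
  have h2 := hk v; have h3 := ler_normD ('d g x v - 'd g 0 v) ('d g 0 v).
  rewrite subrK in h3; apply: (le_trans h3).
  apply: (@le_trans _ _ ((k + c * M) * `|v|)); last first.
    by apply: ler_wpM2r => //; rewrite /L le_max lexx orbT.
  rewrite mulrDl addrC; apply: lerD => //.
  apply: (le_trans h1); apply: ler_wpM2r => //; apply: ler_wpM2l => //.
  by rewrite subrr normr0 add0r subr0; exact: XM.
have L1 : 1 <= L by rewrite /L le_max lexx.
have [eta [S [eta0 S0 HS]]] := hyperbolic_multiplier_sum dg c0 (qf a1 (J13 _ Ja1))
  gX XM L1 hL (hyp a1 Ja1) t1.
pose kap := eta / (2 * (c + 1)).
have c1 : 0 < 2 * (c + 1) by lra.
have kap0 : 0 < kap by rewrite divr_gt0.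
have [d d0 hd] := continuation_uniform cK cont Ja1 kap0.
exists (Num.min d kap); first by rewrite lt_min d0.
exists S => zs uzs hzs.
have close z k' v : K z -> J (u z) -> `|u z - a1| < Num.min d kap ->
    `|'d (f (u z)) (iter k' (f (u z)) (h (u z) z)) v -
      'd g (iter k' g (h a1 z)) v| <= eta * `|v|.
  rewrite lt_min => Kz Ju /andP[ud uk].
  apply: (le_trans (lf _ _ _ _ v (J13 _ Ju) (J13 _ Ja1))).
  apply: ler_wpM2r => //; rewrite !hit //.
  have := hd (u z) (iter k' (f a0) z) ud Ju (Kit k' z Kz).
  move=> hh; apply: (@le_trans _ _ (c * (kap + kap))).
    by apply: ler_wpM2l => //; apply: lerD => //; exact: ltW.
  have -> : c * (kap + kap) = eta * (2 * c) / (2 * (c + 1)) by rewrite /kap; ring.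
  by rewrite ler_pdivrMr //; apply: ler_wpM2l; [exact: ltW|lra].
have [inj _] := conj a1 Ja1.
have hK z : z \in zs -> K z by move=> /hzs[/hZ[]].
(* [HS] is indexed by the points of [X]; [zof] recovers [z] from [h a1 z]. *)
have /(@boolp.choice _ _ (fun x z => X x -> K z /\ h a1 z = x))[zof hzof] :
    forall x, exists z, X x -> K z /\ h a1 z = x.
  move=> x; have [[z Kz <-]|nX] := pselect (X x); first by exists z.
  by exists 0.
have zofK z : K z -> zof (h a1 z) = z.
  move=> Kz; have [|h1 h2] := hzof (h a1 z); first by exists z.
  by apply: inj; rewrite ?inE.
have -> : \sum_(z <- zs) `|s z| `^ (- t) =
    \sum_(x <- [seq h a1 z | z <- zs]) `|s (zof x)| `^ (- t).
  by rewrite big_map; apply: eq_big_seq => z zz; rewrite zofK //; exact: hK.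
apply: (HS _ (p \o zof) (s \o zof)).
  rewrite map_inj_in_uniq // => z z' /hK Kz /hK Kz' E.
  by apply: inj; rewrite ?inE.
move=> _ /mapP[z zz ->]; have Kz := hK z zz.
rewrite /= zofK //; have [Zz uz] := hzs z zz.
have [_ Ju [p0 pz _] s1 [es [r r1 er]]] := hZ z Zz.
have pu : iter (p z) (f (u z)) (h (u z) z) = h (u z) z by rewrite hit // pz.
have du x : differentiable (f (u z)) x by apply: df; exact: J13.
split => //.
- by exists z.
- by rewrite /g hit // pz.
split.
  by apply: (eigen_pseudo_tangent du pu _ es) => k' v; exact: close.
exists r => //.
by apply: (eigen_pseudo_tangent du pu _ er) => k' v; exact: close.
Qed.

(** * Parameters with infinitely many simple sinks *)

Theorem corollary2p6 (R : realType) :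
  exists2 delta : R, 0 < delta &
  forall (b : R) (f : R -> 'rV[R]_2 -> 'rV[R]_2) (a0 : R)
    (K : set 'rV[R]_2) (J : set R) (h : R -> 'rV[R]_2 -> 'rV[R]_2)
    (Om : 'rV[R]_2) (per : nat)
    (C : R) (M N : nat) (V : set 'rV[R]_2) (eta : R)
    (aH : 'rV[R]_2 -> R) (I : 'rV[R]_2 -> set R)
    (sink : 'rV[R]_2 -> R -> set 'rV[R]_2),
  b != 0 ->
  henon_like 4 delta b f ->
  a0 \in `]-3%:R, 1[ ->
  basic_set (f a0) K ->
  hyperbolic_continuation f a0 K J h ->
  K Om ->
  nondegenerate_unfolding 4 f a0 (h ^~ Om) per ->
  simple_sink_data 4 f a0 K J h Om C M N V eta aH I sink ->
  let N1 := [set a : R |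
    infinite_set (simple_sinks f a0 K M V I sink a)] in
  (hausdorff_dim N1 <= (2^-1)%:E)%E /\
  (@lebesgue_measure R).-negligible N1.
Proof.
exists 1 => // b f a0 K J h Om per C M N V eta aH I sink _ hen _ [cK fK _ _ _].
move=> cont _ _ [C0 _ eta0 etaJ data] N1.
pose Z := [set z | [/\ K z, V z & exists2 p, periodic_point (f a0) p z & (M <= p)%N]].
have /(@boolp.choice _ _ (fun z (ps : nat * R) => Z z ->
    [/\ periodic_point (f a0) ps.1 z, (M <= ps.1)%N, 1 < `|ps.2| &
     eigenvalue ('J (iter ps.1 (f (aH z))) (h (aH z) z)) ps.2 /\
     exists2 r, `|r| < 1 & eigenvalue ('J (iter ps.1 (f (aH z))) (h (aH z) z)) r]))
  [ps hps] : forall z, exists ps : nat * R, Z z ->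
    [/\ periodic_point (f a0) ps.1 z, (M <= ps.1)%N, 1 < `|ps.2| &
     eigenvalue ('J (iter ps.1 (f (aH z))) (h (aH z) z)) ps.2 /\
     exists2 r, `|r| < 1 & eigenvalue ('J (iter ps.1 (f (aH z))) (h (aH z) z)) r].
  move=> z; have [[Kz Vz [p pz Mp]]|nZ] := pselect (Z z); last by exists (0%N, 0).
  have [_ [[_ [l [s [l1 s1 el es]]]] _] _] := data z p Kz Vz pz.
  by exists (p, s) => _; split => //; split => //; exists l.
pose s z := (ps z).2; pose r z := C * `|s z| ^- 2.
have sgt z : Z z -> 1 < `|s z| by move=> /hps[].
have r0 z : Z z -> 0 < r z.
  by move=> /sgt h1; rewrite /r mulr_gt0 // invr_gt0 exprn_gt0 //; lra.
have aHJ z : Z z -> aH z \in `[a0 - eta, a0 + eta].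
  move=> Zz; have [Kz Vz _] := Zz; have [pz _ _ _] := hps z Zz.
  have [ha _ _] := data z _ Kz Vz pz.
  by move: ha; rewrite in_itv /= ler_norml => /andP[]; lra.
have sinkI z : Z z -> is_interval (I z) /\ forall a a', I z a -> I z a' -> `|a - a'| <= r z.
  move=> Zz; have [Kz Vz _] := Zz; have [pz Mp s1 [es _]] := hps z Zz.
  have [_ _ /(_ Mp _ s1 es)] := data z _ Kz Vz pz.
  rewrite !in_itv /= => -[[itv I31] _ /andP[_ len] _]; split => // a a' Ia Ia'.
  have ub : has_ubound (I z).
    by exists 1 => x /I31; rewrite /= in_itv /= => /andP[_ /ltW].
  have lb : has_lbound (I z).
    by exists (-3%:R) => x /I31; rewrite /= in_itv /= => /andP[/ltW].
  apply: le_trans len.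
  have := ub_le_sup ub Ia; have := ub_le_sup ub Ia'.
  have := ge_inf lb Ia; have := ge_inf lb Ia'.
  by move=> *; rewrite ler_norml; apply/andP; split; lra.
have sums t : 1 < t -> bounded_sums Z (fun z => `|s z| `^ (- t)).
  move=> t1; apply: (@bounded_sums_cover _ _ Z _ aH (a0 - eta) (a0 + eta)) => //.
  move=> a1 /etaJ Ja1.
  apply: (local_multiplier_sum (p := fun z => (ps z).1) hen cK fK cont Ja1 t1).
  move=> z Zz; have [Kz _ _] := Zz; have [pz _ s1 es] := hps z Zz.
  by split => //; exact/etaJ/aHJ.
have rsums s' : 2^-1 < s' -> bounded_sums Z (fun z => r z `^ s').
  move=> hs; have [|B hB] := sums (2 * s'); first lra.
  exists (C `^ s' * B) => zs uzs hzs.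
  apply: (@le_trans _ _ (\sum_(z <- zs) C `^ s' * `|s z| `^ (- (2 * s')))).
    rewrite big_seq [leRHS]big_seq le_eqVlt; apply/orP; left; apply/eqP.
    apply: eq_bigr => z /hzs Zz; have h1 := sgt z Zz.
    rewrite /r powRM ?invr_ge0 ?exprn_ge0 ?(ltW C0) //; congr (_ * _).
    by rewrite -powR_invn // -powRrM mulNr.
  rewrite -mulr_sumr; apply: ler_wpM2l; first exact: powR_ge0.
  exact: hB.
have inf a : N1 a -> infinite_set [set z | Z z /\ I z a].
  move=> na fin; apply: na.
  apply: (@sub_finite_set _ _ ((fun z => sink z a) @` [set z | Z z /\ I z a])).
    move=> S [z [p [Kz Vz pz Mp [Iz ->]]]]; exists z => //; split => //.
    by split => //; exists p.
  exact: finite_image.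
split.
  apply: hausdorff_dim_le; first by rewrite invr_ge0.
  move=> s' hs; apply: (limsup_hausdorff_measure0 (Z := Z) (I := I) (r := r)) => //.
  - by apply: lt_trans hs; rewrite invr_gt0.
  - by move=> z a a' Zz; have [_ h1] := sinkI z Zz; exact: h1.
  - exact: rsums.
apply: (limsup_negligible (Z := Z) (I := I) (r := r)) => //.
- by move=> z Zz; have [h1 _] := sinkI z Zz.
- by move=> z a a' Zz; have [_ h1] := sinkI z Zz; exact: h1.
have [|B hB] := rsums 1; first lra.
exists B => zs uzs hzs; have := hB zs uzs hzs; apply: le_trans.
rewrite big_seq [leRHS]big_seq; apply: ler_sum => z /hzs/r0 h1.
by rewrite powRr1 // ltW.
Qed.
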